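(* Let $0<\gamma\leq 1$ and $\epsilon>0$ be real numbers, and let $(d_i)_{i\geq 1}$ and $(p_i)_{i\geq 1}$ be sequences of (positive rational) primes such that $d_i\geq 2d_{i-1}$ for all $i\geq 2$ and $e^{d_i^{1-\gamma+\epsilon/2}}\leq p_i\leq 2e^{d_i^{1-\gamma+\epsilon/2}}$ for all $i\geq 1$. Then the field $\mathbb{Q}(p_i^{1/d_i};\, i\in\mathbb{N})$ is $\gamma$-Northcott but not $(\gamma-\epsilon)$-Bogomolov.
   Context: $\overline{\mathbb{Q}}$ denotes the field of algebraic numbers, $h(\cdot)$ the absolute logarithmic Weil height on $\overline{\mathbb{Q}}$, and $\deg\alpha=[\mathbb{Q}(\alpha):\mathbb{Q}]$ for $\alpha\in\overline{\mathbb{Q}}$. For a real number $\gamma$ (any sign) put $f_\gamma(\alpha)=(\deg\alpha)^{\gamma}h(\alpha)$. A subset $S\subset\overline{\mathbb{Q}}$ is called $\gamma$-Northcott if $\{\alpha\in S : f_\gamma(\alpha)\leq X\}$ is finite for every $X\in\mathbb{R}$. It is called $\gamma$-Bogomolov if $0$ is not an accumulation point of the set $f_\gamma(S)=\{f_\gamma(\alpha):\alpha\in S\}$ in the usual topology of $\mathbb{R}$. Here $\mathbb{N}=\{1,2,3,\ldots\}$, $p_i^{1/d_i}$ denotes the positive real $d_i$-th root of $p_i$, and $\mathbb{Q}(p_i^{1/d_i};\, i\in\mathbb{N})$ is the subfield of $\overline{\mathbb{Q}}$ generated over $\mathbb{Q}$ by all these numbers. *)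

(* Defs.v *)
(* The field of algebraic numbers is algC, with its order, norm and n-th roots:
   for x >= 0, n.-root x is the nonnegative real n-th root. Heights take values
   in an arbitrary realType R. *)
From HB Require Import structures.
From mathcomp Require Import all_boot all_order all_algebra all_field.
From mathcomp Require Import all_classical all_reals all_analysis.

Set Implicit Arguments.
Unset Strict Implicit.
Unset Printing Implicit Defensive.

Import Order.TTheory GRing.Theory Num.Theory.
Import numFieldNormedType.Exports.

Local Open Scope classical_set_scope.
Local Open Scope ring_scope.

(* minCpoly a is the monic minimal polynomial of a over the rationals. *)
Definition alg_deg (a : algC) : nat := (size (minCpoly a)).-1.

(* The minimal polynomial of a over the integers: the rational minimal
   polynomial, cleared of denominators and made primitive. zprimitive also
   normalizes the sign, so the leading coefficient is positive. *)
Definition min_zpoly (a : algC) : {poly int} :=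
  zprimitive (tag (rat_poly_scale (sval (minCpolyP a)))).

(* The conjugates of a, i.e. all the complex roots of its minimal polynomial. *)
Definition conjugates (a : algC) : seq algC :=
  sval (closed_field_poly_normal (minCpoly a)).

(* The embedding into R of the real algebraic numbers, by Dedekind cuts; it is
   only ever applied to real elements of algC. *)
Definition alg_real (R : realType) (x : algC) : R :=
  sup [set (ratr q : R) | q in [set q : rat | (ratr q : algC) <= x]].

(* The absolute logarithmic Weil height
     h(a) = (log a_0 + \sum_i log max(1, |a_i|)) / deg a,
   where a_0 \prod_i (X - a_i) is the minimal polynomial of a over the integers.
   The term log a_0 is the total contribution of the non-archimedean places,
   the sum over the conjugates is that of the archimedean ones. *)
Definition weil_height (R : realType) (a : algC) : R :=
  (ln (lead_coef (min_zpoly a))%:~R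
   + \sum_(z <- conjugates a) ln (Num.max 1 (alg_real R `|z|)))
  / (alg_deg a)%:R.

Definition weighted_height (R : realType) (gamma : R) (a : algC) : R :=
  (alg_deg a)%:R `^ gamma * weil_height R a.

Definition northcott (R : realType) (gamma : R) (S : set algC) : Prop :=
  forall X : R, finite_set [set a | S a /\ weighted_height gamma a <= X].

Definition bogomolov (R : realType) (gamma : R) (S : set algC) : Prop :=
  ~ limit_point (weighted_height gamma @` S) 0.

(* The subfield generated by A over the rationals: the intersection of all
   subfields containing A. *)
Definition gen_field (A : set algC) : set algC :=
  [set x | forall K : {pred algC}, divring_closed K ->
     (forall a, A a -> a \in K) -> x \in K].

(* Main.v *)
(* Write pi_i = p_i^(1/d_i), m_n = d_1 ... d_n and theta_n = pi_1 ... pi_n. Then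
   Q(pi_1, ..., pi_n) = Q(theta_n), of degree m_n, and theta_n^(m_n) is an
   integer a.

   Let alpha be in Q(theta_n) but not in K = Q(theta_(n-1)), where n is large,
   and let d = d_n, p = p_n, m = m_n. Then p > m and p <> p_j for j < n. The
   product of the differences of the conjugates of alpha over K, taken over all
   embeddings of K and multiplied by a power of the leading coefficient of the
   minimal polynomial, is a nonzero integer A. By Leibniz's formula for
   Vandermonde determinants, |A| <= (d!)^(2m/d) exp(2(d-1) m h(alpha)). On the
   other hand p is tamely ramified, so p^((d-1)m/d) divides A: if
   alpha = sum_s c_s theta^s is p-integral, then so are the c_s theta^s, hence
   c_s theta^s is divisible by p^(1/d) when d does not divide s, and only these
   terms contribute to the differences. In general, replace alpha by
   1/(b - alpha), where b is an integer which is not a root mod p of the minimal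
   polynomial of alpha; such a b exists because p > m, and A is unchanged.
   Therefore log p <= 4 log d + 2 d h(alpha), and as deg alpha >= d the weighted
   height of alpha is at least about d^(eps/2); the Northcott property follows
   from that of Q(theta_n). The pi_i, whose heights are log p_i / d_i, show the
   failure of the Bogomolov property. *)
Require Import Defs.
From HB Require Import structures.
From mathcomp Require Import all_boot all_order all_algebra all_field.
From mathcomp Require Import all_classical all_reals all_analysis.
From mathcomp Require Import perm ring lra zify.

Set Implicit Arguments.
Unset Strict Implicit.
Unset Printing Implicit Defensive.

Import Order.TTheory GRing.Theory Num.Theory.
Import numFieldNormedType.Exports.

Local Open Scope classical_set_scope.
Local Open Scope ring_scope.

Local Notation pQtoC := (map_poly (ratr : rat -> algC)).

(** * Automorphisms of the algebraic numbers and algebraic integers *)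

(** The roots of [minCpoly x] generate a number field which is a splitting field, hence normal. An
    automorphism of it taking [x] to [y] extends to all of algC. *)
Lemma conj_minCpoly_aut (x y : algC) : root (minCpoly x) y ->
  exists nu : {rmorphism algC -> algC}, nu x = y.
Proof.
have [s Ds] := closed_field_poly_normal (minCpoly x).
move: (Ds); rewrite (monicP (minCpoly_monic x)) scale1r => {}Ds.
have [q [Dq mon_q] dvq] := minCpolyP x.
have rootE z : root (minCpoly x) z = (z \in s) by rewrite Ds root_prod_XsubC.
have xs : x \in s by rewrite -rootE root_minCpoly.
rewrite rootE => ys.
have [Qs [QsC [s1 Ds1 gens1]]] := num_field_exists s.
have QsC_in r : map_poly QsC (map_poly (in_alg Qs) r) = pQtoC r.
  rewrite -map_poly_comp; apply: eq_map_poly => a /=.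
  by rewrite alg_num_field fmorph_rat.
have axQ : splitting_field_axiom Qs.
  exists (map_poly (in_alg Qs) q).
    by apply/polyOverP=> i; rewrite coef_map memvZ ?mem1v.
  exists s1 => //.
  have -> : map_poly (in_alg Qs) q = \prod_(z <- s1) ('X - z%:P).
    apply: (map_poly_inj QsC); rewrite QsC_in -Dq Ds -Ds1 big_map rmorph_prod /=.
    by apply: eq_bigr => z _; rewrite map_polyXsubC.
  exact: eqpxx.
pose mixQ := FieldExt_isSplittingField.Build rat Qs axQ.
pose L : splittingFieldType rat := HB.pack Qs mixQ.
have [x1 x1s Dx1] : exists2 x1, x1 \in s1 & x = QsC x1.
  by apply/mapP; rewrite Ds1.
have [y1 y1s Dy1] : exists2 y1, y1 \in s1 & y = QsC y1.
  by apply/mapP; rewrite Ds1.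
have r_xy : root (minPoly 1%AS (x1 : L)) y1.
  have /polyOver1P[r Dr] := minPolyOver 1%AS (x1 : L).
  rewrite -(fmorph_root QsC) Dr QsC_in -Dy1.
  have : root (pQtoC r) x by rewrite -QsC_in -Dr Dx1 fmorph_root root_minPoly.
  rewrite dvq => /dvdpP[r1 ->]; rewrite rmorphM /= rootM -Dq rootE ys.
  by rewrite orbT.
have [g _ gxy] := normalField_root_minPoly (sub1v _)
  (normalFieldf (1%AS : {subfield L})) (memvf (x1 : L)) r_xy.
have [nu Dnu] := extend_algC_subfield_aut QsC (g : {rmorphism L -> L}).
by exists nu; rewrite Dx1 -Dnu Dy1 -gxy.
Qed.

(** Every conjugate of [x] is an image of [x], so [minCpoly x] is a power of X - x, and its
    subleading coefficient, which is rational, is a nonzero multiple of [x]. *)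
Lemma fixed_Crat (x : algC) :
  (forall nu : {rmorphism algC -> algC}, nu x = x) -> x \in Crat.
Proof.
move=> fx.
have [s Ds] := closed_field_poly_normal (minCpoly x).
move: (Ds); rewrite (monicP (minCpoly_monic x)) scale1r => {}Ds.
have [q [Dq mon_q] dvq] := minCpolyP x.
have sx z : z \in s -> z = x.
  rewrite -root_prod_XsubC -Ds => /conj_minCpoly_aut[nu <-]; exact: fx.
have Es : s = nseq (size s) x.
  by apply/all_pred1P/allP => z /sx->; apply/eqP.
have n0 : size s != 0%N.
  have := size_minCpoly x; rewrite Ds size_prod_XsubC ltnS.
  by case: (size s).
have := coefPn_prod_XsubC n0.
rewrite -Ds Dq coef_map /= => Dn.
have {Dn} : ratr q`_(size s).-1 = - (x *+ size s).
  by rewrite Dn [in LHS]Es big_nseq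
      iter_addr_0.
move=> Dx; have -> : x = - (ratr q`_(size s).-1) / (size s)%:R.
  by rewrite Dx opprK -[x *+ _]mulr_natr mulfK // pnatr_eq0.
by rewrite rpredM ?rpredN ?rpredV ?rpred_nat ?Crat_rat.
Qed.

(** Transitivity of integrality. *)
Lemma root_monic_polyOver_Aint (p : {poly algC}) x :
  root p x -> p \is monic -> p \is a polyOver Aint -> x \in Aint.
Proof.
move=> px mon_p /polyOverP Ap.
have [q mon_q qx] : integralOver (intr : int -> algC) x.
  apply: (integral_root_monic mon_p px) => z /(nthP 0)[i _ <-].
  have := Ap i; rewrite unfold_in => /floorpP[q Dq].
  exists q; last by rewrite -Dq root_minCpoly.
  have inj_ZC : injective (intr : int -> algC) by exact: intr_inj.
  by rewrite monicE -(inj_eq inj_ZC) -lead_coef_map_inj // -Dq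
     (monicP (minCpoly_monic _)).
apply: (root_monic_Aint qx); rewrite ?monic_map //.
by apply/polyOverP=> i; rewrite coef_map intr_int.
Qed.

(** With l the leading coefficient and N the degree, multiplying p(x) = 0 by l^(N-1) gives a monic
    equation for l x, whose coefficients are again integral. *)
Lemma Aint_lead_root (p : {poly algC}) x :
  p \is a polyOver Aint -> root p x -> lead_coef p * x \in Aint.
Proof.
move=> /polyOverP Ap px.
have [->|p0] := eqVneq p 0; first by rewrite lead_coef0 mul0r.
have szp := root_size_gt1 p0 px.
pose l := lead_coef p; pose N := (size p).-1.
have N0 : (0 < N)%N by rewrite /N; case: (size p) szp => [|[]].
pose r := \poly_(i < N) (p`_i * l ^+ (N.-1 - i)).
pose q := 'X^N + r.
have szr : (size r <= N)%N by apply: size_poly.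
have Al : l \in Aint by apply: Ap.
apply: (@root_monic_polyOver_Aint q).
- rewrite /root /q hornerD hornerXn horner_poly.
  have := px; rewrite /root horner_coef (polySpred p0) -/N big_ord_recr /= -/l.
  move=> /eqP e; apply/eqP; rewrite -[RHS](mulr0 (l ^+ N.-1)) -[X in _ = _ * X]e.
  rewrite mulrDr mulr_sumr [LHS]addrC; congr (_ + _).
    apply: eq_bigr => i _; rewrite exprMn [RHS]mulrCA -!mulrA; congr (_ * _).
    rewrite !mulrA -exprD subnK //; by rewrite -ltnS prednK.
  by rewrite mulrA -exprSr prednK // exprMn.
- by rewrite monicE lead_coefDl ?lead_coefXn // size_polyXn ltnS.
- apply: rpredD; first by rewrite rpredX ?polyOverX.
  by apply/polyOverP=> i; rewrite coef_poly; case: ifP => // _; rewrite rpredM ?rpredX.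
Qed.

(** A form of Gauss's lemma, by induction on the size: the top term of [p] times X - x has
    coefficients l and -l x, both integral by [Aint_lead_root], so this term can be subtracted from
    [p]. *)
Lemma polyOver_Aint_divXsubC (p : {poly algC}) x :
  p * ('X - x%:P) \is a polyOver Aint -> p \is a polyOver Aint.
Proof.
have [n] := ubnP (size p); elim: n p => // n IH p; rewrite ltnS => szp Ap.
have [->|p0] := eqVneq p 0; first exact: rpred0.
set l := lead_coef p.
have lE : lead_coef (p * ('X - x%:P)) = l.
  by rewrite lead_coefM lead_coefXsubC mulr1.
have Al : l \in Aint by rewrite -lE; apply: (polyOverP Ap).
have Alx : l * x \in Aint.
  by rewrite -lE; apply: Aint_lead_root Ap _; rewrite rootM root_XsubC eqxx orbT.
have Aq : l *: 'X^((size p).-1) \is a polyOver Aint.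
  by rewrite polyOverZ // rpredX ?polyOverX.
rewrite -[p](subrK (l *: 'X^((size p).-1))); apply: rpredD => //.
apply: IH; last first.
  rewrite mulrBl; apply: rpredB => //.
  rewrite mulrBr -!scalerAl; apply: rpredB.
    by rewrite -exprSr polyOverZ // rpredX ?polyOverX.
  by rewrite mulrC mul_polyC scalerA polyOverZ // rpredX ?polyOverX.
apply: leq_trans szp; rewrite (polySpred p0) ltnS.
apply/leq_sizeP => i; rewrite leq_eqVlt => /orP[/eqP <-|lt_i].
  by rewrite coefB coefZ coefXn eqxx mulr1 subrr.
rewrite coefB coefZ coefXn (gtn_eqF lt_i) mulr0 subr0 nth_default //.
by rewrite (polySpred p0).
Qed.

Section SubProducts.

Variables (I : finType) (B : algC) (a : I -> algC).
Hypothesis AintB : B *: \prod_i ('X - (a i)%:P) \is a polyOver Aint.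

(** The factors outside [P] are divided out one at a time. The two lemmas that follow evaluate this
    polynomial: one factor [B] clears the denominators of any product of distinct members of the
    family. *)
Lemma polyOver_Aint_subprod (P : pred I) :
  B *: \prod_(i | P i) ('X - (a i)%:P) \is a polyOver Aint.
Proof.
move: AintB; rewrite (bigID P) /= scalerAl.
move: (B *: _) => p; rewrite -big_filter.
elim: [seq _ <- _ | _] => [|i s IH]; first by rewrite big_nil mulr1.
by rewrite big_cons mulrCA mulrC => /polyOver_Aint_divXsubC/IH.
Qed.

Lemma Aint_subprodB (P : pred I) b : b \in Aint ->
  B * \prod_(i | P i) (b - a i) \in Aint.
Proof.
move=> Ab; have /rpred_horner/(_ Ab) := polyOver_Aint_subprod P.
by rewrite hornerZ horner_prod; under eq_bigr do rewrite hornerXsubC.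
Qed.

Lemma Aint_subprod (P : pred I) : B * \prod_(i | P i) a i \in Aint.
Proof.
have := Aint_subprodB P Aint0.
under eq_bigr do rewrite sub0r; rewrite prodrN mulrCA => h.
by rewrite -[_ * _](signrMK #|P|) rpredMsign.
Qed.

End SubProducts.

(** * Heights *)

Lemma min_zpolyE (a : algC) :
  map_poly intr (min_zpoly a) = (lead_coef (min_zpoly a))%:~R *: minCpoly a.
Proof.
rewrite /min_zpoly; case: (minCpolyP a) => q [Dq mon_q] dvq /=.
case: (rat_poly_scale q) => z [b b0 Ez] /=; rewrite Dq.
set f := zprimitive z.
have [c Ec] : exists c : rat, map_poly intr f = c *: q.
  exists (b%:~R / (zcontents z)%:~R).
  have z0 : zcontents z != 0.
    rewrite zcontents_eq0; apply: contraTneq mon_q => z0.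
    by rewrite Ez z0 rmorph0 scaler0 monicE lead_coef0 eq_sym oner_eq0.
  rewrite Ez {2}(zpolyEprim z) -/f map_polyZ !scalerA /=.
  set u : rat := b%:~R; set v : rat := (zcontents z)%:~R.
  have -> : u / v * u^-1 * v = 1 by rewrite /u /v; field; rewrite !intr_eq0 z0 b0.
  by rewrite scale1r.
have lf : (lead_coef f)%:~R = c.
  have inj_ZQ : injective (intr : int -> rat) by exact: intr_inj.
  by rewrite -lead_coef_map_inj // Ec lead_coefZ (monicP mon_q) mulr1.
have -> : map_poly intr f = map_poly (ratr : rat -> algC) (map_poly intr f).
  by rewrite -[RHS]map_poly_comp; apply: eq_map_poly => i /=; rewrite ratr_int.
by rewrite Ec map_polyZ /= -lf ratr_int.
Qed.

Lemma lead_min_zpoly_gt0 (a : algC) : 0 < lead_coef (min_zpoly a).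
Proof.
rewrite -sgz_gt0 /min_zpoly; case: (minCpolyP a) => q [Dq mon_q] dvq /=.
case: (rat_poly_scale q) => z [b b0 Ez] /=; rewrite sgz_lead_primitive.
suff -> : z != 0 by [].
apply: contraTneq mon_q => z0.
by rewrite Ez z0 rmorph0 scaler0 monicE lead_coef0 eq_sym oner_eq0.
Qed.

Lemma zcontents_min_zpoly (a : algC) : zcontents (min_zpoly a) = 1.
Proof.
have := lead_min_zpoly_gt0 a; have := erefl (min_zpoly a).
rewrite {2 3}/min_zpoly => E; rewrite {1}/min_zpoly zcontents_primitive.
case: eqP => // ->; by rewrite zprimitive0 lead_coef0 ltxx.
Qed.

Lemma conjugatesE (a : algC) :
  minCpoly a = \prod_(z <- conjugates a) ('X - z%:P).
Proof.
rewrite /conjugates; case: closed_field_poly_normal => s /= Es.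
by rewrite {1}Es (monicP (minCpoly_monic a)) scale1r.
Qed.

Lemma mem_conjugates (a z : algC) : (z \in conjugates a) = root (minCpoly a) z.
Proof. by rewrite conjugatesE root_prod_XsubC. Qed.

Lemma size_conjugates (a : algC) : size (conjugates a) = alg_deg a.
Proof. by rewrite /alg_deg conjugatesE size_prod_XsubC. Qed.

Lemma alg_deg_gt0 (a : algC) : (0 < alg_deg a)%N.
Proof. by rewrite /alg_deg; case: (size _) (size_minCpoly a) => [|[]]. Qed.

(** A monic polynomial has content 1, so the constant relating it to the primitive [min_zpoly a] is
    1. *)
Lemma min_zpoly_monic (a : algC) (g : {poly int}) :
  minCpoly a = map_poly intr g -> min_zpoly a = g.
Proof.
move=> Dg; set f := min_zpoly a.
have inj_ZC : injective (intr : int -> algC) by exact: intr_inj.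
have Ef : f = lead_coef f *: g.
  apply: (map_inj_poly inj_ZC (rmorph0 _)).
  by rewrite min_zpolyE Dg map_polyZ.
have mon_g : g \is monic.
  by rewrite monicE -(inj_eq inj_ZC) -lead_coef_map_inj // -Dg
     (monicP (minCpoly_monic _)).
have := zcontents_min_zpoly a; rewrite -/f Ef zcontentsZ zcontents_monic // mulr1.
by move=> ->; rewrite scale1r.
Qed.

(** * Real algebraic numbers as elements of [R] *)

Section AlgReal.

Variable R : realType.
Implicit Types (x y : algC) (q r : rat).
Local Notation iota := (alg_real R).

Local Notation cut x :=
  [set (ratr q : R) | q in [set q : rat | (ratr q : algC) <= x]].

Lemma has_sup_cut x : 0 <= x -> has_sup (cut x).
Proof.
move=> x0; split; first by exists (ratr 0), 0 => //=; rewrite rmorph0.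
exists (Num.bound x)%:R => _ [q /= qx <-].
have := le_lt_trans qx (archi_boundP x0).
by rewrite -(ratr_nat algC) -(ratr_nat R) ltr_rat ler_rat => /ltW.
Qed.

Lemma alg_real_ge x q : 0 <= x -> ratr q <= x -> ratr q <= iota x.
Proof. by move=> x0 qx; apply: sup_ubound; [case: (has_sup_cut x0)|exists q]. Qed.

Lemma alg_real_gt x q : 0 <= x -> ratr q < iota x -> ratr q <= x.
Proof.
move=> x0 /(sup_gt (has_sup_cut x0).1)[_ [r /= rx <-]].
by rewrite ltr_rat => /ltW qr; apply: le_trans rx; rewrite ler_rat.
Qed.

Lemma alg_real_lt x q : 0 <= x -> iota x < ratr q -> x < ratr q.
Proof.
have rq : (ratr q : algC) \is Num.real by apply/Creal_Crat/Crat_rat.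
move=> x0 h; rewrite (real_ltNge (ger0_real x0) rq).
by apply: contraTN h => qx; rewrite -leNgt alg_real_ge.
Qed.

Lemma alg_real_rat q : 0 <= q -> iota (ratr q) = ratr q.
Proof.
move=> q0; have rq0 : 0 <= ratr q :> algC by rewrite ler0q.
apply/eqP; rewrite eq_le alg_real_ge // andbT.
apply: sup_le_ub; first by case: (has_sup_cut rq0).
by move=> _ [r /= + <-]; rewrite !ler_rat.
Qed.

Lemma alg_real_nat n : iota n%:R = n%:R.
Proof. by rewrite -(ratr_nat algC) alg_real_rat ?ler0n // ratr_nat. Qed.

Lemma alg_real_ge0 x : 0 <= x -> 0 <= iota x.
Proof.
by move=> x0; have := @alg_real_ge x 0 x0; rewrite !rmorph0; apply.
Qed.

Lemma alg_real_le x y : 0 <= x -> x <= y -> iota x <= iota y.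
Proof.
move=> x0 xy; have y0 := le_trans x0 xy.
apply: sup_le_ub; first by case: (has_sup_cut x0).
by move=> _ [q /= qx <-]; apply: alg_real_ge => //; apply: le_trans xy.
Qed.

(** Rational numbers are what both fields can compare. If the two sides differed, rationals r and s
    could be chosen on the same side of the images of x and y, with r s still strictly on the wrong
    side of the image of x y; multiplying the bounds in algC contradicts this. *)
Lemma alg_realM x y : 0 <= x -> 0 <= y -> iota (x * y) = iota x * iota y.
Proof.
move=> x0 y0; have xy0 := mulr_ge0 x0 y0.
have [ix0 iy0] := (alg_real_ge0 x0, alg_real_ge0 y0).
apply/eqP; rewrite eq_le; apply/andP; split; rewrite leNgt; apply/negP => h.
- suff [r [s [rx sy rs]]] : exists r s : rat,
      [/\ iota x < ratr r, iota y < ratr s & ratr r * ratr s < iota (x * y)].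
    have xr := alg_real_lt x0 rx; have ys := alg_real_lt y0 sy.
    move: rs; rewrite -rmorphM => /(alg_real_gt xy0).
    rewrite rmorphM /= => /le_lt_trans/(_ (ltr_pM x0 y0 xr ys)).
    by rewrite ltxx.
  (* The generic choice of [r] divides by [iota y]; when that is 0, any [r] above [iota x] will
     do. *)
  have [v0|v0] := eqVneq (iota y) 0.
    have t0 : 0 < iota (x * y) by rewrite v0 mulr0 in h.
    have /rat_in_itvoo[r /itvP ur] : iota x < iota x + 1 by rewrite ltrDl.
    have r0 : 0 < ratr r :> R by rewrite (le_lt_trans ix0) ?ur.
    have /rat_in_itvoo[s /itvP us] : 0 < iota (x * y) / ratr r by rewrite divr_gt0.
    by exists r, s; rewrite v0 mulrC -ltr_pdivlMr // !(ur, us).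
  have v1 : 0 < iota y by rewrite lt_def v0.
  have /rat_in_itvoo[r /itvP ur] : iota x < iota (x * y) / iota y.
    by rewrite ltr_pdivlMr.
  have r0 : 0 < ratr r :> R by rewrite (le_lt_trans ix0) ?ur.
  have /rat_in_itvoo[s /itvP us] : iota y < iota (x * y) / ratr r.
    by rewrite ltr_pdivlMr // mulrC -ltr_pdivlMr // ur.
  by exists r, s; rewrite mulrC -ltr_pdivlMr // !(ur, us).
- have t0 := alg_real_ge0 xy0.
  have v1 : 0 < iota y.
    rewrite lt_def iy0 andbT; apply: contraTneq h => ->.
    by rewrite mulr0 -leNgt.
  have /rat_in_itvoo[r /itvP ur] : iota (x * y) / iota y < iota x.
    by rewrite ltr_pdivrMr.
  have r0 : 0 < ratr r :> R.
    by apply: (@le_lt_trans _ _ (iota (x * y) / iota y)); rewrite ?divr_ge0 ?ur.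
  have /rat_in_itvoo[s /itvP us] : iota (x * y) / ratr r < iota y.
    by rewrite ltr_pdivrMr // [iota y * _]mulrC -ltr_pdivrMr // ur.
  have s0 : 0 < ratr s :> R.
    apply: (@le_lt_trans _ _ (iota (x * y) / ratr r)); rewrite ?us //.
    by rewrite divr_ge0 // ltW.
  have rx : ratr r <= x by apply: alg_real_gt; rewrite ?ur.
  have sy : ratr s <= y by apply: alg_real_gt; rewrite ?us.
  rewrite !ltr0q in r0 s0.
  have : ratr (r * s) <= x * y by rewrite rmorphM ler_pM // ler0q ltW.
  move/(alg_real_ge xy0); rewrite rmorphM leNgt => /negP; apply.
  by rewrite [ratr r * _]mulrC -ltr_pdivrMr ?ltr0q // us.
Qed.

Lemma alg_real_prod (I : Type) (s : seq I) (f : I -> algC) :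
  (forall i, 0 <= f i) ->
  iota (\prod_(i <- s) f i) = \prod_(i <- s) iota (f i).
Proof.
move=> f0; elim: s => [|i s IH]; first by rewrite !big_nil (alg_real_nat 1).
by rewrite !big_cons alg_realM ?IH // prodr_ge0.
Qed.

Lemma alg_realX x n : 0 <= x -> iota (x ^+ n) = iota x ^+ n.
Proof.
move=> x0; elim: n => [|n IH]; first by rewrite !expr0 (alg_real_nat 1).
by rewrite !exprS alg_realM ?exprn_ge0 // IH.
Qed.

Lemma alg_real_max1 x : 0 <= x -> iota (Num.max 1 x) = Num.max 1 (iota x).
Proof.
move=> x0; have [lt1x|] := boolP (1 < x).
  have h := alg_real_le ler01 (ltW lt1x).
  by rewrite /Num.max lt1x; move: h; rewrite (alg_real_nat 1) => /max_idPr.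
rewrite -real_leNgt ?real1 ?ger0_real // => lex1.
have := alg_real_le x0 lex1; rewrite (alg_real_nat 1) => /max_idPl ->.
by rewrite /Num.max (le_gtF lex1) (alg_real_nat 1).
Qed.

End AlgReal.

Lemma ln_prod (R : realType) (I : Type) (s : seq I) (F : I -> R) :
  (forall i, 0 < F i) -> ln (\prod_(i <- s) F i) = \sum_(i <- s) ln (F i).
Proof.
move=> F0; elim: s => [|i s IH]; first by rewrite !big_nil ln1.
by rewrite !big_cons lnM ?IH // posrE // prodr_gt0.
Qed.

(** * Heights of families listing every conjugate equally often *)

Section HeightOfFamily.

Variables (a : algC) (I : finType) (al : I -> algC) (r : nat).
Hypothesis alE : \prod_i ('X - (al i)%:P) = minCpoly a ^+ r.

Local Notation B := (lead_coef (min_zpoly a) ^+ r).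

Lemma lead_family_gt0 : 0 < B.
Proof. by rewrite exprn_gt0 // lead_min_zpoly_gt0. Qed.

Lemma min_zpolyXE :
  map_poly intr (min_zpoly a ^+ r) = B%:~R *: \prod_i ('X - (al i)%:P).
Proof. by rewrite rmorphXn /= min_zpolyE exprZn rmorphXn alE. Qed.

Lemma perm_family :
  perm_eq [seq al i | i <- index_enum I] (flatten (nseq r (conjugates a))).
Proof.
apply/prod_XsubC_eq; rewrite big_map alE big_flatten big_nseq conjugatesE.
by rewrite iter_mulr_1.
Qed.

Lemma card_family : #|I| = (r * alg_deg a)%N.
Proof.
have /perm_size := perm_family; rewrite size_map [index_enum _]unlock -enumT -cardE => ->.
by rewrite size_flatten /shape map_nseq sumn_nseq size_conjugates mulnC.
Qed.

Lemma big_family (A : Type) (idx : A) (op : Monoid.com_law idx) (F : algC -> A) :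
  \big[op/idx]_i F (al i) = iter r (op (\big[op/idx]_(z <- conjugates a) F z)) idx.
Proof.
by rewrite -(big_map al xpredT F) (perm_big _ perm_family) big_flatten big_nseq.
Qed.

(** The family runs [r] times through the conjugates, so both sides are [r] times the logarithm of
    the Mahler measure of [a]. The argument of the logarithm is formed in algC, where the estimates
    are made. *)
Lemma weil_height_family (R : realType) :
  #|I|%:R * weil_height R a =
  ln (alg_real R (B%:~R * \prod_i Num.max 1 `|al i|)).
Proof.
have B0 : 0 < lead_coef (min_zpoly a) := lead_min_zpoly_gt0 a.
have max0 i : 0 <= Num.max 1 `|al i| by rewrite /Num.max; case: ifP.
have maxR i : 0 < Num.max 1 (alg_real R `|al i|) :> R by rewrite lt_max ltr01.
have BE : alg_real R B%:~R = B%:~R.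
  by have := @gez0_abs B (ltW lead_family_gt0) => <-; rewrite -!pmulrn alg_real_nat.
rewrite alg_realM ?prodr_ge0 ?ler0z ?(ltW lead_family_gt0) //.
rewrite alg_real_prod // BE; under eq_bigr do rewrite alg_real_max1 //.
rewrite lnM ?posrE ?ltr0z ?lead_family_gt0 ?prodr_gt0 //.
rewrite ln_prod //.
rewrite rmorphXn /= lnXn ?ltr0z //.
rewrite (big_family _ (fun z => ln (Num.max 1 (alg_real R `|z|)))).
rewrite iter_addr_0 -mulrnDl -[RHS]mulr_natl card_family natrM /weil_height.
rewrite -mulrA; congr (_ * _); rewrite mulrCA divff ?mulr1 //.
by rewrite pnatr_eq0 -lt0n alg_deg_gt0.
Qed.

(** Transports an estimate proved in algC to an inequality between heights in [R]. *)
Lemma ln_le_height (R : realType) (n c e : nat) : (0 < n)%N ->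
  n%:R <= c%:R * (B%:~R * \prod_i Num.max 1 `|al i|) ^+ e ->
  ln (n%:R : R) <= ln (c%:R : R) + e%:R * (#|I|%:R * weil_height R a).
Proof.
move=> n0; rewrite weil_height_family.
pose H : algC := B%:~R * \prod_i Num.max 1 `|al i|; rewrite -/H => le_n.
have max0 i : 0 <= Num.max 1 `|al i| by rewrite /Num.max; case: ifP.
have H0 : 0 <= H by rewrite mulr_ge0 ?prodr_ge0 ?ler0z ?(ltW lead_family_gt0).
have := alg_real_le R (ler0n _ n) le_n.
rewrite alg_realM ?ler0n ?exprn_ge0 // !alg_real_nat alg_realX // => {}le_n.
have n0R : 0 < n%:R :> R by rewrite ltr0n.
have := lt_le_trans n0R le_n.
have [->|c0] := posnP c; first by rewrite mul0r ltxx.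
rewrite pmulr_rgt0 ?ltr0n // => He0.
have iH0 : 0 <= alg_real R H := alg_real_ge0 R H0.
have -> : e%:R * ln (alg_real R H) = ln (alg_real R H ^+ e).
  (* For positive exponents, positivity of the power gives that of its base, which [lnXn] needs; for
     exponent 0 both sides vanish. *)
  case: e He0 {le_n} => [|e]; first by rewrite expr0 mul0r ln1.
  rewrite lt_def expf_eq0 /= => /andP[Hn0 _].
  by rewrite lnXn ?lt_def ?Hn0 // mulr_natl.
rewrite -lnM ?posrE ?ltr0n // ler_ln ?posrE //.
by rewrite mulr_gt0 ?ltr0n.
Qed.

End HeightOfFamily.

(** * Northcott's theorem *)

Lemma normC_coef_prod_XsubC (s : seq algC) j :
  `|(\prod_(z <- s) ('X - z%:P))`_j| <=
  2 ^+ size s * \prod_(z <- s) Num.max 1 `|z|.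
Proof.
have max0 z : 0 <= Num.max 1 `|z : algC| by rewrite /Num.max; case: ifP.
have max1 z : 1 <= Num.max 1 `|z : algC| by rewrite /Num.max; case: ifP => // /ltW.
have maxz z : `|z : algC| <= Num.max 1 `|z|.
  rewrite /Num.max; have [//|] := boolP (1 < `|z|).
  by rewrite -real_leNgt ?real1 ?normr_real.
elim: s j => [|z s IH] j.
  rewrite !big_nil mulr1 coef1 normr_nat /=; by case: (_ == _).
rewrite !big_cons mulrBl coefB mul_polyC coefZ coefXM /= exprS.
set g := \prod_(i <- s) _ in IH *; set P := \prod_(i <- s) _ in IH *.
have P0 : 0 <= 2 ^+ size s * P by rewrite mulr_ge0 ?exprn_ge0 ?prodr_ge0.
(* A coefficient of (X - z) g is one coefficient of g minus z times another. Each part is at most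
   the old bound times max(1, |z|), whence one more factor 2. *)
apply: le_trans (ler_normB _ _) _.
rewrite mulrACA mulrDl mul1r mulrDl; apply: lerD.
  case: ifP => _; first by rewrite normr0 mulr_ge0.
  by apply: le_trans (IH _) _; rewrite ler_peMl.
by rewrite normrM ler_pM.
Qed.

Lemma normC_coef_min_zpoly (a : algC) j :
  `|(min_zpoly a)`_j|%:~R <= 2 ^+ alg_deg a * ((lead_coef (min_zpoly a))%:~R *
     \prod_(z <- conjugates a) Num.max 1 `|z|) :> algC.
Proof.
have -> : `|(min_zpoly a)`_j|%:~R = `|(map_poly intr (min_zpoly a) : {poly algC})`_j|.
  by rewrite coef_map /= intr_norm.
have l0 := ltW (lead_min_zpoly_gt0 a).
rewrite min_zpolyE coefZ normrM ger0_norm ?ler0z // mulrCA ler_wpM2l ?ler0z //.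
by rewrite {1}conjugatesE -size_conjugates normC_coef_prod_XsubC.
Qed.

(** The coefficients of [min_zpoly a] are bounded in terms of degree and height, so finitely many
    polynomials occur, each with finitely many roots. *)
Lemma finite_bounded_height (R : realType) (m : nat) (X : R) :
  finite_set [set a : algC | (alg_deg a <= m)%N /\ weil_height R a <= X].
Proof.
(* A coefficient is at most 2^deg exp(deg h), where deg is at most [m]. The absolute value of [X]
   makes the bound increase with the degree. *)
pose C := m%:R * (ln 2 + `|X|); pose T := Num.truncn (expR C).
(* The entries of [g] are the coefficients shifted by [T], so that the range from -T to T becomes an
   ordinal type. *)
pose P (g : {ffun 'I_m.+1 -> 'I_(2 * T).+1}) : {poly algC} :=
  \poly_(i < m.+1) ((g (inord i) : nat)%:R - T%:R).
have finP g : finite_set [set z | P g != 0 /\ root (P g) z].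
  have [s Ds] := closed_field_poly_normal (P g).
  apply: sub_finite_set (finite_seq s) => z /= [g0].
  by rewrite Ds rootZ ?lead_coef_eq0 // root_prod_XsubC.
have := bigcup_finite (@finite_finset _ setT) (fun g _ => finP g).
apply: sub_finite_set => a /= [degm hX].
set f := min_zpoly a.
have bound j : (absz (f`_j)%R <= T)%N.
  have [->//|n0] := posnP (absz f`_j).
  pose al (i : 'I_(size (conjugates a))) := nth 0 (conjugates a) i.
  have prod_al (A : Type) (idx : A) op (F : algC -> A) :
      \big[op/idx]_i F (al i) = \big[op/idx]_(z <- conjugates a) F z.
    by rewrite [RHS](big_nth 0) big_mkord.
  have alE : \prod_i ('X - (al i)%:P) = minCpoly a ^+ 1.
    by rewrite expr1 [RHS]conjugatesE (prod_al _ _ _ (fun z => 'X - z%:P)).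
  have := @ln_le_height _ _ _ _ alE R (absz f`_j) (2 ^ alg_deg a)%N 1%N n0.
  rewrite !expr1 (prod_al _ _ _ (fun z => Num.max 1 `|z|)) natrX mul1r.
  rewrite card_ord size_conjugates.
  have := normC_coef_min_zpoly a j; rewrite -/f -abszE -pmulrn => le1 /(_ le1).
  rewrite natrX lnXn // -[ln _ *+ _]mulr_natl -mulrDr => le2.
  rewrite truncn_ge_nat ?expR_ge0 // -[_%:R]lnK ?posrE ?ltr0n // ler_expR.
  apply: le_trans le2 _; rewrite /C.
  have ln2_ge0 : 0 <= ln 2 :> R by rewrite ln_ge0 // ler1n.
  apply: (@le_trans _ _ ((alg_deg a)%:R * (ln 2 + `|X|))).
    rewrite ler_wpM2l // lerD2l; apply: le_trans hX _; exact: ler_norm.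
  by rewrite ler_wpM2r ?addr_ge0 // ler_nat.
pose g := [ffun i : 'I_m.+1 => inord (absz (f`_i + T%:Z)) : 'I_(2 * T).+1].
have Dg : P g = map_poly intr f.
  apply/polyP => i; rewrite coef_poly coef_map /=; case: ltnP => [lt_im|le_mi].
    rewrite ffunE !inordK //; last first.
      have := bound i; lia.
    have -> : (absz (f`_i + T%:Z))%:R = (f`_i + T%:Z)%:~R :> algC.
      by rewrite pmulrn; congr (_%:~R); have := bound i; lia.
    by rewrite rmorphD /= addrK.
  rewrite nth_default // /f.
  have <- : size (map_poly intr (min_zpoly a) : {poly algC}) = size (min_zpoly a).
    by apply: size_map_inj_poly; [exact: intr_inj|].
  rewrite min_zpolyE size_scale ?intr_eq0 ?gt_eqF ?lead_min_zpoly_gt0 //.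
  apply: leq_trans le_mi; move: degm; rewrite /alg_deg.
  by case: (size _).
exists g => //=; rewrite Dg min_zpolyE.
have l0 : (lead_coef (min_zpoly a))%:~R != 0 :> algC.
  by rewrite intr_eq0 gt_eqF ?lead_min_zpoly_gt0.
by rewrite scaler_eq0 negb_or l0 minCpoly_eq0 rootZ ?root_minCpoly.
Qed.

(** * Pure extensions *)

Section PureField.

Variables (theta w : algC) (a m' d : nat).
Hypotheses (m'_gt0 : (0 < m')%N) (d_gt0 : (0 < d)%N) (theta_gt0 : 0 < theta).
Local Notation m := (m' * d)%N.
Hypotheses (theta_m : theta ^+ m = a%:R)
  (min_theta : minCpoly theta = 'X^m - a%:R%:P) (w_prim : m.-primitive_root w).

Local Notation I := ('I_m' * 'I_d)%type.

(* The pair (g, t) stands for the exponent g + m' t of w, so that the conjugates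
   of theta over Q(theta^d) are those with the same g. *)
Definition pure_conj (k : I) : algC := theta * w ^+ (k.1 + m' * k.2)%N.
Local Notation rt := pure_conj.

Lemma pure_conj_neq0 k : rt k != 0.
Proof.
apply: mulf_neq0; first exact: lt0r_neq0.
apply: expf_neq0.
have := prim_expr_order w_prim; apply: contra_eqN => /eqP ->.
by rewrite expr0n muln_eq0 !gtn_eqF // eq_sym oner_eq0.
Qed.

Lemma pure_conjX k : rt k ^+ m = a%:R.
Proof.
rewrite exprMn theta_m -[RHS]mulr1; congr (_ * _).
by rewrite exprAC (prim_expr_order w_prim) expr1n.
Qed.

Lemma pure_conj_lt (k : I) : (k.1 + m' * k.2 < m)%N.
Proof.
case: k => g t /=; apply: (@leq_trans (m' * t.+1)).
  by rewrite mulnS ltn_add2r.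
by rewrite leq_mul2l ltn_ord orbT.
Qed.

Lemma pure_conj_inj : injective rt.
Proof.
move=> k l /(mulfI (lt0r_neq0 theta_gt0))/eqP.
rewrite (eq_prim_root_expr w_prim) !modn_small ?pure_conj_lt // => /eqP.
case: k l => [g t] [g' t'] /= E.
have Eg : g = g'.
  apply/val_inj => /=; have /(congr1 (modn^~ m')) := E.
  by rewrite /= !(mulnC m') !(addnC _ (_ * m')%N) !modnMDl !modn_small.
move: E; rewrite Eg => /addnI/eqP; rewrite eqn_pmul2l // => /eqP/val_inj ->.
by [].
Qed.

Lemma pure_conjP z : z ^+ m = a%:R -> exists k, z = rt k.
Proof.
move=> zm.
have : (z / theta) ^+ m = 1.
  rewrite exprMn exprVn zm theta_m divff // -theta_m expf_neq0 //.
  exact: lt0r_neq0.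
case/(prim_rootP w_prim) => i Ei.
have lt_g : (i %% m' < m')%N by rewrite ltn_mod.
have lt_t : (i %/ m' < d)%N by rewrite ltn_divLR // (mulnC d) ltn_ord.
exists (Ordinal lt_g, Ordinal lt_t); rewrite /rt /= addnC mulnC -divn_eq -Ei.
by rewrite mulrC divfK // lt0r_neq0.
Qed.

(** [w ^+ d] has order [m'], and modulo [m'] the exponent of [w] in [rt k] is [k.1]. *)
Lemma pure_conj_expd k l : (rt k ^+ d == rt l ^+ d) = (k.1 == l.1).
Proof.
rewrite !exprMn (inj_eq (mulfI _)) ?expf_neq0 ?lt0r_neq0 // -!exprM.
rewrite (eq_prim_root_expr w_prim) -!muln_modl eqn_pmul2r //.
by rewrite !(mulnC m') !(addnC _ (_ * m')%N) !modnMDl !modn_small.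
Qed.

Lemma pure_conj_aut k : exists nu : {rmorphism algC -> algC}, nu theta = rt k.
Proof.
apply: conj_minCpoly_aut; rewrite min_theta /root.
by rewrite hornerD hornerN hornerC hornerXn pure_conjX subrr.
Qed.

(** An automorphism permutes the roots of X^m - a. It respects the blocks because these are the
    fibres of the d-th power map. *)
Lemma aut_pure_conj (nu : {rmorphism algC -> algC}) :
  exists rho : {perm I}, (forall k, nu (rt k) = rt (rho k)) /\
    (forall k l, ((rho k).1 == (rho l).1) = (k.1 == l.1)).
Proof.
have ex k : exists l, nu (rt k) == rt l.
  have [|l ->] := @pure_conjP (nu (rt k)); last by exists l.
  by rewrite -rmorphXn pure_conjX rmorph_nat.
pose f k := xchoose (ex k).
have fE k : nu (rt k) = rt (f k) by apply/eqP/(xchooseP (ex k)).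
have f_inj : injective f.
  by move=> k l Ekl; apply/pure_conj_inj/(fmorph_inj nu); rewrite !fE Ekl.
exists (perm f_inj); split=> [k|k l]; first by rewrite permE.
by rewrite !permE -!pure_conj_expd -!fE -!rmorphXn (inj_eq (fmorph_inj nu)).
Qed.

End PureField.

Lemma map_ratr_aut (nu : {rmorphism algC -> algC}) (q : {poly rat}) :
  map_poly nu (pQtoC q) = pQtoC q.
Proof. by rewrite -map_poly_comp; apply: eq_map_poly => x /=; rewrite fmorph_rat. Qed.

Lemma aut_horner_rat (nu : {rmorphism algC -> algC}) (q : {poly rat}) x :
  nu (pQtoC q).[x] = (pQtoC q).[nu x].
Proof. by rewrite -[in RHS](map_ratr_aut nu) horner_map. Qed.

Lemma polyOver_Crat_ex (p : {poly algC}) :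
  p \is a polyOver Crat -> exists q, p = pQtoC q.
Proof.
move=> /polyOverP Cp; exists (map_poly getCrat p); apply/polyP=> i.
by rewrite coef_map /= coef_map_id0 ?getCratK //; have := getCratK Crat0;
   rewrite -(rmorph0 (ratr : {rmorphism rat -> algC})) => /fmorph_inj.
Qed.

(** A nonconstant [q] has a root, which is conjugate to [x]; as [q] is rational, [x] is a root as
    well, so the minimal polynomial divides [q] and induction applies to the quotient. *)
Lemma minCpolyX_of_conjugates (x : algC) (q : {poly rat}) : q \is monic ->
  (forall z, root (pQtoC q) z -> root (minCpoly x) z) ->
  exists r, pQtoC q = minCpoly x ^+ r.
Proof.
have [f [Df mon_f] dvf] := minCpolyP x.
have [n] := ubnP (size q); elim: n q => // n IH q; rewrite ltnS => szq mon_q rq.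
have [sz1|szn1] := eqVneq (size (pQtoC q)) 1%N.
  exists 0%N; rewrite expr0.
  have /size_poly1P[c c0 Ec] : size (pQtoC q) == 1%N by rewrite sz1.
  have /monicP : pQtoC q \is monic by rewrite map_monic.
  by rewrite Ec lead_coefC => ->.
have [z qz] := closed_rootP _ szn1.
have [nu nux] := conj_minCpoly_aut (rq z qz).
have : root (pQtoC q) x.
  by rewrite -(fmorph_root nu) map_ratr_aut nux.
rewrite dvf => /dvdpP[q1 Dq].
have mon_q1 : q1 \is monic by move: mon_q; rewrite Dq monicMr.
have [|z1 q1z1|r Er] := IH q1 _ mon_q1.
- apply: leq_trans szq; rewrite Dq size_Mmonic ?monic_neq0 //.
  have := size_minCpoly x; rewrite Df size_map_poly.
  by case: (size f) => [|[|k]] // _; rewrite addnS /= addnS ltnS leq_addr.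
- by apply: rq; rewrite Dq rmorphM rootM q1z1.
by exists r.+1; rewrite Dq rmorphM /= Er -Df exprSr.
Qed.

(** The product is invariant under all automorphisms, hence rational, and all its roots are
    conjugates of [x]. *)
Lemma prod_conjugates_minCpolyX (x : algC) (I : finType) (al : I -> algC) :
  (forall nu : {rmorphism algC -> algC},
     exists rho : {perm I}, forall i, nu (al i) = al (rho i)) ->
  (forall i, root (minCpoly x) (al i)) ->
  exists r, \prod_i ('X - (al i)%:P) = minCpoly x ^+ r.
Proof.
move=> perm_al root_al; set P := \prod_i _.
have [|q Dq] := @polyOver_Crat_ex P.
  apply/polyOverP => j; apply: fixed_Crat => nu; rewrite -coef_map.
  suff -> : map_poly nu P = P by []; have [rho rhoE] := perm_al nu.
  rewrite rmorph_prod /P [RHS](reindex_inj (@perm_inj _ rho)) /=.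
  by apply: eq_bigr => i _; rewrite map_polyXsubC rhoE.
have mon_q : q \is monic.
  by rewrite -(map_monic (ratr : {rmorphism rat -> algC})) -Dq monic_prod_XsubC.
rewrite Dq; apply: minCpolyX_of_conjugates => // z.
rewrite -Dq /P /root horner_prod prodf_seq_eq0 => /hasP[i _].
by rewrite !hornerE subr_eq0 => /eqP ->; apply: root_al.
Qed.

Lemma sum_prim_root_expr (d s : nat) (zeta : algC) : d.-primitive_root zeta ->
  \sum_(t < d) (zeta ^+ t) ^+ s = if (d %| s)%N then d%:R else 0.
Proof.
move=> pz; under eq_bigr do rewrite exprAC.
case: ifP => [ds|/negbT ds].
  have -> : zeta ^+ s = 1 by apply/eqP; rewrite -(prim_order_dvd pz).
  by under eq_bigr do rewrite expr1n; rewrite sumr_const card_ord.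
have z1 : zeta ^+ s - 1 != 0 by rewrite subr_eq0 -(prim_order_dvd pz).
apply: (mulfI z1); rewrite mulr0 -subrX1 exprAC (prim_expr_order pz) expr1n.
exact: subrr.
Qed.

(* If C(theta zeta^t) = C(theta) for the t in a subset S of Z/d, the product of
   the theta zeta^t, t in S, is fixed by every automorphism fixing C(theta) and
   theta^d, complex conjugation included, so its square is theta^(2#|S|); hence
   d divides #|S| as soon as S contains some t <> 0. *)
Lemma conj_horner_neq (theta zeta : algC) (d : nat) (C : {poly rat}) :
  0 < theta -> prime d -> (2 < d)%N -> d.-primitive_root zeta ->
  (forall t : nat, exists nu : {rmorphism algC -> algC},
     nu theta = theta * zeta ^+ t) ->
  (forall D, (pQtoC C).[theta] != (pQtoC D).[theta ^+ d]) ->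
  forall t, (0 < t < d)%N -> (pQtoC C).[theta * zeta ^+ t] != (pQtoC C).[theta].
Proof.
move=> th0 pr_d d2 pz autz nC t /andP[t0 td]; apply/negP => /eqP Et.
have d0 : (0 < d)%N by exact: prime_gt0.
have thn0 : theta != 0 by exact: lt0r_neq0.
pose z (i : 'I_d) := theta * zeta ^+ i.
have z_inj : injective z.
  move=> i j /(mulfI thn0)/eqP; rewrite (eq_prim_root_expr pz) !modn_small //.
  by move=> /eqP/val_inj.
have zP x : x ^+ d = theta ^+ d -> exists i, x = z i.
  move=> xd; have : (x / theta) ^+ d = 1.
    by rewrite exprMn exprVn xd divff // expf_neq0.
  by case/(prim_rootP pz) => i Ei; exists i; rewrite /z -Ei mulrC divfK.
have zd i : z i ^+ d = theta ^+ d.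
  by rewrite exprMn exprAC (prim_expr_order pz) expr1n mulr1.
pose S := [set i | (pQtoC C).[z i] == (pQtoC C).[theta]]%SET.
pose be := \prod_(i in S) z i.
have fix_be (nu : {rmorphism algC -> algC}) :
    nu (pQtoC C).[theta] = (pQtoC C).[theta] -> nu (theta ^+ d) = theta ^+ d ->
    nu be = be.
  move=> nuC nud.
  have ex i : exists j, nu (z i) == z j.
    by have [|j ->] := zP (nu (z i)); [rewrite -rmorphXn zd|exists j].
  pose f i := xchoose (ex i).
  have fE i : nu (z i) = z (f i) by apply/eqP/(xchooseP (ex i)).
  have f_inj : injective f.
    by move=> i j Eij; apply/z_inj/(fmorph_inj nu); rewrite !fE Eij.
  have fS i : (f i \in S) = (i \in S).
    by rewrite !inE -fE -aut_horner_rat -[X in _ == X]nuC (inj_eq (fmorph_inj nu)).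
  rewrite /be rmorph_prod [RHS](reindex_inj f_inj) /=.
  by apply: eq_big => [i|i _]; rewrite ?fS.
have be2 : be ^+ 2 = theta ^+ (2 * #|S|).
  have th_real : theta^* = theta by apply/CrealP/gtr0_real.
  have conj_be : be^* = be.
    have conjQ : (pQtoC C).[theta]^* = (pQtoC C).[theta].
      by rewrite (aut_horner_rat Num.conj); congr (_.[_]); apply: th_real.
    by apply: fix_be => //=; rewrite rmorphXn /= th_real.
  rewrite mulnC exprM; have -> : be ^+ 2 = `|be| ^+ 2 by rewrite normCK conj_be.
  congr (_ ^+ 2); rewrite /be normr_prod.
  have zN i : `|z i| = theta.
    rewrite normrM gtr0_norm // normrX; suff -> : `|zeta| = 1 by rewrite expr1n mulr1.
    apply/eqP; rewrite -(pexpr_eq1 d0) ?normr_ge0 // -normrX.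
    by rewrite (prim_expr_order pz) normr1.
  by under eq_bigr do rewrite zN; rewrite prodr_const.
have [nu nuth] := autz t.
have := fix_be nu; rewrite aut_horner_rat nuth rmorphXn /= nuth => /(_ Et).
rewrite -[t]/(nat_of_ord (Ordinal td)) zd => /(_ erefl) /(congr1 (fun x => x ^+ 2)).
rewrite -rmorphXn be2 rmorphXn /= nuth exprMn -[RHS]mulr1.
move/(mulfI (expf_neq0 _ thn0))/eqP; rewrite -exprM -(prim_order_dvd pz).
(* The prime [d] divides t * 2 * #|S|; since t < d and d > 2, it must divide #|S|. *)
rewrite Euclid_dvdM // (gtnNdvd t0 td) Euclid_dvdM //= (gtnNdvd _ d2) //=.
have S0 : (0 < #|S|)%N.
  by apply/card_gt0P; exists (Ordinal d0); rewrite inE /z /= mulr1.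
have Sd : (#|S| <= d)%N by rewrite -[d in leqRHS]card_ord max_card.
move=> dS; have {dS} ES : #|S| = d by apply/eqP; rewrite eqn_leq Sd dvdn_leq.
have all_S i : (pQtoC C).[z i] = (pQtoC C).[theta].
  apply/eqP; suff : i \in S by rewrite inE.
  suff -> : S = [set: 'I_d]%SET by rewrite inE.
  by apply/eqP; rewrite eqEcard finset.subsetT cardsT card_ord ES leqnn.
(* Now C takes the same value at all [z i]. Averaging over [i] removes the powers of theta whose
   exponent [d] does not divide, so this value is a polynomial in theta^d. *)
pose D := \sum_(s < size C | (d %| s)%N) C`_s *: 'X^(s %/ d).
case/negP: (nC D); apply/eqP.
have dn0 : d%:R != 0 :> algC by rewrite pnatr_eq0 -lt0n.
apply: (mulfI dn0).
have -> : d%:R * (pQtoC C).[theta] = \sum_i (pQtoC C).[z i].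
  by under eq_bigr do rewrite all_S; rewrite sumr_const card_ord mulr_natl.
have szC : size (pQtoC C) = size C by rewrite size_map_poly.
under eq_bigr do rewrite horner_coef szC.
rewrite exchange_big /=.
transitivity (\sum_(s < size C)
  (d%:R * if (d %| s)%N then ratr C`_s * theta ^+ s else 0)).
  apply: eq_bigr => s _; rewrite coef_map /=.
  under eq_bigr do rewrite exprMn mulrA.
  rewrite -mulr_sumr (sum_prim_root_expr _ pz).
  by case: ifP => _; rewrite ?mulr0 // mulrC.
rewrite -mulr_sumr; congr (_ * _); rewrite -big_mkcond /= /D rmorph_sum horner_sum.
apply: eq_bigr => s ds; rewrite /= map_polyZ map_polyXn hornerZ hornerXn -exprM.
by rewrite mulnC divnK.
Qed.

(** * Discriminants taken block by block *)

Lemma prod_fiber_neq (I J : finType) (F : I * J -> algC) (k : I * J) :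
  \prod_(l | (l.1 == k.1) && (l != k)) F l = \prod_(j | j != k.2) F (k.1, j).
Proof.
case: k => i j /=.
rewrite (reindex_onto (fun j' => (i, j')) snd) /=; last first.
  by case=> i' j' /= /andP[/eqP <-].
by apply: eq_bigl => j'; rewrite xpair_eqE !eqxx /= andbT.
Qed.

(** Each unordered pair occurs in both orders. *)
Lemma prod_neq_sqr (d : nat) (x : 'I_d -> algC) :
  \prod_t \prod_(t' | t' != t) (x t - x t') =
  (-1) ^+ (\sum_(t < d) \sum_(t' < d | (t < t')%N) 1)%N *
  (\prod_(t < d) \prod_(t' < d | (t < t')%N) (x t' - x t)) ^+ 2.
Proof.
transitivity (\prod_(t < d) (\prod_(t' < d | (t < t')%N) (x t - x t') *
                             \prod_(t' < d | (t' < t)%N) (x t - x t'))).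
  apply: eq_bigr => t _; rewrite (bigID (fun t' : 'I_d => t < t')%N) /=.
  by congr (_ * _); apply: eq_bigl => t'; rewrite -val_eqE /=; lia.
rewrite big_split /= [X in _ * X](exchange_big_dep xpredT) //= expr2 mulrA.
congr (_ * _); rewrite -prodrXr -big_split; apply: eq_bigr => t _ /=.
rewrite -prodrXr -big_split; apply: eq_bigr => t' _ /=.
by rewrite expr1 mulN1r opprB.
Qed.

Section GroupedVandermonde.

Variables (n d : nat) (B : algC) (al : 'I_n * 'I_d -> algC).
Hypothesis B_ge0 : 0 <= B.
Hypothesis AintB : B *: \prod_k ('X - (al k)%:P) \is a polyOver Aint.

Let V (g : 'I_n) :=
  \prod_(t < d) \prod_(t' < d | (t < t')%N) (al (g, t') - al (g, t)).

Let VE g : V g =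
  \sum_(s : 'S_d) (-1) ^+ s * \prod_(t < d) al (g, t) ^+ s t.
Proof.
have := det_Vandermonde (\row_t al (g, t)); rewrite -det_tr.
set a := (\row_t _) => E; rewrite /V; symmetry.
rewrite -[RHS](_ : \prod_(i < d) \prod_(j < d | (i < j)%N) (a 0 j - a 0 i) = _).
  rewrite -E; apply: eq_bigr => s _; congr (_ * _); apply: eq_bigr => t _.
  by rewrite !mxE.
by apply: eq_bigr => t _; apply: eq_bigr => t' _; rewrite !mxE.
Qed.

Let max0 k : 0 <= Num.max 1 `|al k|.
Proof. by rewrite /Num.max; case: ifP. Qed.

Let max1 k : 1 <= Num.max 1 `|al k|.
Proof. by rewrite /Num.max; case: ifP => // /ltW. Qed.

Let normV g : `|V g| <= d`!%:R * \prod_(t < d) Num.max 1 `|al (g, t)| ^+ d.-1.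
Proof.
rewrite VE; apply: le_trans (ler_norm_sum _ _ _) _.
apply: (@le_trans _ _ (\sum_(s : 'S_d) \prod_(t < d) Num.max 1 `|al (g, t)| ^+ d.-1)).
  apply: ler_sum => s _; rewrite normrM normrX normrN1 expr1n mul1r normr_prod.
  apply: ler_prod => t _; rewrite normr_ge0 normrX /=.
  apply: (@le_trans _ _ (Num.max 1 `|al (g, t)| ^+ s t)).
    rewrite lerXn2r ?nnegrE //; rewrite /Num.max.
    have [//|] := boolP (1 < `|al (g, t)|).
    by rewrite -real_leNgt ?real1 ?normr_real.
  by apply: ler_weXn2l => //; rewrite -ltnS prednK // (leq_trans _ (ltn_ord t)).
by rewrite sumr_const card_Sn mulr_natl.
Qed.

Let W := B ^+ d.-1 * \prod_g V g.

(** In the Leibniz expansion every exponent is at most d - 1. Slicing the exponents by level [j]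
    writes each monomial as d - 1 products of distinct members of the family, and one factor [B]
    makes each of these integral. *)
Let Aint_W : W \in Aint.
Proof.
rewrite /W; under eq_bigr do rewrite VE.
rewrite bigA_distr_bigA mulr_sumr; apply: rpred_sum => f _.
rewrite big_split /= mulrCA rpredM //.
  by apply: rpred_prod => g _; rewrite rpredX // rpredN.
rewrite pair_bigA /=.
rewrite -[d.-1]card_ord -prodr_const.
have -> : \prod_(k : 'I_n * 'I_d) al (k.1, k.2) ^+ f k.1 k.2 =
    \prod_(j < d.-1) \prod_(k | (j < f k.1 k.2)%N) al k.
  rewrite [RHS](exchange_big_dep xpredT) //=; apply: eq_bigr => k _.
  have le_f : (f k.1 k.2 <= d.-1)%N.
    by rewrite -ltnS prednK // (leq_trans _ (ltn_ord k.2)).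
  rewrite -(big_ord_widen _ (fun=> al k) le_f) prodr_const card_ord.
  by rewrite -surjective_pairing.
rewrite -big_split /=; apply: rpred_prod => j _.
exact: Aint_subprod AintB _.
Qed.

Local Notation disc :=
  (\prod_k \prod_(l | (l.1 == k.1) && (l != k)) (al k - al l)).

Let discE : exists N, disc = (-1) ^+ N * (\prod_g V g) ^+ 2.
Proof.
exists (\sum_(g < n) \sum_(t < d) \sum_(t' < d | (t < t')%N) 1)%N.
under eq_bigr do rewrite prod_fiber_neq.
have -> : \prod_(k : 'I_n * 'I_d) \prod_(j | j != k.2) (al k - al (k.1, j)) =
    \prod_g \prod_t \prod_(t' | t' != t) (al (g, t) - al (g, t')).
  by rewrite pair_bigA; apply: eq_bigr => -[g t] _.
rewrite -prodrXl -prodrXr -big_split; apply: eq_bigr => g _ /=.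
exact: prod_neq_sqr.
Qed.

Lemma Aint_grouped_disc : B ^+ (2 * d.-1) * disc \in Aint.
Proof.
have [N ->] := discE; rewrite mulrCA mulnC exprM -exprMn.
by rewrite rpredM ?rpredX ?rpredN // Aint_W.
Qed.

Lemma normC_grouped_disc :
  `|B ^+ (2 * d.-1) * disc| <=
  (d`! ^ (2 * n))%N%:R * (B * \prod_k Num.max 1 `|al k|) ^+ (2 * d.-1).
Proof.
have [N ->] := discE; rewrite mulrCA normrM normrX normrN1 expr1n mul1r.
rewrite ![(2 * _)%N]mulnC !exprM expnM natrX -!exprMn normrX.
apply: lerXn2r; rewrite ?nnegrE ?normr_ge0 //.
  by rewrite mulr_ge0 ?exprn_ge0 ?mulr_ge0 ?prodr_ge0.
rewrite normrM normrX ger0_norm // exprMn mulrCA ler_wpM2l ?exprn_ge0 //.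
rewrite normr_prod; apply: (@le_trans _ _
  (\prod_(g < n) (d`!%:R * \prod_(t < d) Num.max 1 `|al (g, t)| ^+ d.-1))).
  by apply: ler_prod => g _; rewrite normr_ge0 normV.
rewrite big_split /= prodr_const card_ord natrX.
have -> : (\prod_k Num.max 1 `|al k|) ^+ d.-1 =
    \prod_(g < n) \prod_(t < d) Num.max 1 `|al (g, t)| ^+ d.-1.
  by rewrite pair_bigA /= -prodrXl; apply: eq_bigr => -[].
exact: lexx.
Qed.

End GroupedVandermonde.

(** Let v be the p-adic valuation. Then v(n) = m' (d v(q) + s) is a multiple of m'. If it were less
    than m' it would be 0, and [d] would divide [s]. *)
Lemma dvdz_rat_power (m' d p a' s : nat) (q : rat) (n : int) :
  (0 < m')%N -> (0 < d)%N -> prime p -> ~~ (p %| a')%N -> ~~ (d %| s)%N ->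
  q ^+ (m' * d) * ((p ^ m' * a') ^ s)%N%:R = n%:~R -> ((p ^ m')%N %| n)%Z.
Proof.
move=> m'0 d0 pr_p pa' ds; set c := ((p ^ m' * a') ^ s)%N => Eq.
have p0 := prime_gt0 pr_p.
have a'0 : (0 < a')%N by case: (posnP a') pa' => // ->; rewrite dvdn0.
have E : (absz (numq q) ^ (m' * d) * c = absz n * absz (denq q) ^ (m' * d))%N.
  have Ez : numq q ^+ (m' * d) * c%:Z = n * denq q ^+ (m' * d).
    have inj_ZQ : injective (intr : int -> rat) by exact: intr_inj.
    apply: inj_ZQ; rewrite !rmorphM !rmorphXn /= -Eq -pmulrn.
    by rewrite [RHS]mulrAC -exprMn numqE /c natrX.
  by have := congr1 absz Ez; rewrite !abszM !abszX.
have [->|n0] := eqVneq n 0; first exact: dvdz0.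
have md0 : (0 < m' * d)%N by rewrite muln_gt0 m'0.
have u0 : (0 < absz (numq q))%N.
  rewrite absz_gt0 numq_eq0; apply: contraNneq n0 => q0.
  by move: Eq; rewrite q0 expr0n (gtn_eqF md0) mul0r => /esym/eqP; rewrite intr_eq0.
have v0 : (0 < absz (denq q))%N by rewrite absz_gt0 denq_neq0.
have := congr1 (logn p) E.
rewrite !lognM ?expn_gt0 ?muln_gt0 ?expn_gt0 ?u0 ?v0 ?absz_gt0 ?n0 ?a'0 ?p0 //.
rewrite !lognX lognM ?expn_gt0 ?p0 // pfactorK //.
rewrite (@logn_coprime p a') ?prime_coprime // addn0 => El.
rewrite dvdzE /= pfactor_dvdn ?absz_gt0 //.
set l := logn p (absz n) in El *; set u := logn p _ in El; set v := logn p _ in El.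
rewrite leqNgt; apply/negP => lt_l.
have m'l : (m' %| l)%N.
  rewrite -(@dvdn_addl (m' * d * v)); last by rewrite -mulnA dvdn_mulr.
  rewrite -El; apply: dvdn_add; last exact: dvdn_mull.
  by rewrite -mulnA dvdn_mulr.
have l0 : l = 0%N.
  apply/eqP; rewrite -leqn0 leqNgt; apply/negP => /dvdn_leq/(_ m'l).
  by rewrite leqNgt lt_l.
case/negP: ds; move: El; rewrite l0 add0n (mulnC s) -!mulnA -mulnDr => /eqP.
rewrite eqn_pmul2l // => /eqP Ed.
by rewrite -(@dvdn_addr (d * u)) ?dvdn_mulr // Ed dvdn_mulr.
Qed.

(** * Divisibility by the tamely ramified prime *)

Section PureFieldDisc.

Variables (theta w : algC) (m' d p a' : nat).
Hypotheses (m'_gt0 : (0 < m')%N) (d_gt0 : (0 < d)%N) (theta_gt0 : 0 < theta).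
Hypotheses (pr_p : prime p) (pa' : ~~ (p %| a')%N).
Local Notation m := (m' * d)%N.
Local Notation a := (p ^ m' * a')%N.
Hypotheses (theta_m : theta ^+ m = a%:R)
  (w_prim : m.-primitive_root w).
Local Notation I := ('I_m' * 'I_d)%type.
Local Notation rt := (@pure_conj theta w m' d).
Variables (be : I -> algC) (b : int).
Hypothesis be_equiv : forall (nu : {rmorphism algC -> algC}) (rho : {perm I}),
  (forall k, nu (rt k) = rt (rho k)) -> forall k, nu (be k) = be (rho k).
Hypothesis be_int : forall k, b%:~R * be k \in Aint.

Let rt_neq0 : forall k, rt k != 0 := pure_conj_neq0 m'_gt0 d_gt0 theta_gt0 w_prim.
(* The coordinate of m b be(k) on rt(k)^s, by Fourier inversion. *)
Let y s := b%:~R * \sum_k be k / rt k ^+ s.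

Let rat_y s : y s \in Crat.
Proof.
apply: fixed_Crat => nu.
have [rho [rhoE _]] := aut_pure_conj m'_gt0 d_gt0 theta_gt0 theta_m w_prim nu.
rewrite rmorphM rmorph_int; congr (_ * _).
rewrite rmorph_sum [RHS](reindex_inj (@perm_inj _ rho)) /=.
apply: eq_bigr => k _.
by rewrite rmorphM fmorphV rmorphXn (be_equiv rhoE) rhoE.
Qed.

(** The quotient of [theta] by [rt k] is a root of unity, so this is a sum of the integers
    [b * be k] times roots of unity. *)
Let Aint_y s : y s * theta ^+ s \in Aint.
Proof.
have th0 := lt0r_neq0 theta_gt0.
rewrite -mulrA mulr_suml mulr_sumr; apply: rpred_sum => k _.
rewrite -mulrA mulrA rpredM // /pure_conj exprMn invfM mulrAC.
rewrite mulVf ?expf_neq0 // mul1r -exprM.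
have -> : (w ^+ ((k.1 + m' * k.2) * s))^-1 = w^-1 ^+ ((k.1 + m' * k.2) * s).
  by rewrite exprVn.
have w1 : w * w ^+ m.-1 = 1.
  by rewrite -exprS prednK ?muln_gt0 ?m'_gt0 // (prim_expr_order w_prim).
have w0 : w != 0.
  by apply: contra_eqN w1 => /eqP ->; rewrite mul0r eq_sym oner_eq0.
apply: rpredX; have -> : w^-1 = w ^+ m.-1.
  by apply: (mulfI w0); rewrite w1 divff.
by rewrite rpredX // (Aint_prim_root w_prim).
Qed.

Let y_inv k : m%:R * (b%:~R * be k) = \sum_(s < m) y s * rt k ^+ s.
Proof.
rewrite /y; under eq_bigr do rewrite -mulrA mulr_suml.
rewrite -mulr_sumr exchange_big /= mulrCA; congr (_ * _).
under eq_bigr do under eq_bigr do rewrite -mulrA -exprVn -exprMn.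
under eq_bigr do rewrite -mulr_sumr.
rewrite (bigD1 k) //= [X in _ + X]big1 => [|l nlk].
  rewrite addr0 mulrC mulVf //; under eq_bigr do rewrite expr1n.
  by rewrite sumr_const card_ord.
apply/eqP; rewrite mulf_eq0; apply/orP; right; apply/eqP.
have u1 : (rt l)^-1 * rt k - 1 != 0.
  rewrite subr_eq0; apply: contraNneq nlk => E.
  have /eqP := congr1 (fun x => rt l * x) E; rewrite mulVKf // mulr1 eq_sym.
  by move=> /eqP/(pure_conj_inj m'_gt0 theta_gt0 w_prim) ->.
apply: (mulfI u1); rewrite mulr0 -subrX1 exprMn exprVn.
rewrite !(pure_conjX theta_m w_prim) mulVf ?subrr // -theta_m.
by rewrite expf_neq0 // lt0r_neq0.
Qed.

Variable pi : algC.
Hypothesis pi_d : pi ^+ d = p%:R.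

Let pi_m : pi ^+ m = (p ^ m')%:R.
Proof. by rewrite mulnC exprM pi_d natrX. Qed.

(** The m-th power of [y s * theta ^+ s] is a rational integer, divisible by p^m' = pi^m according
    to [dvdz_rat_power]; the quotient by [pi] is thus a root of X^m - n' with n' an integer. *)
Let Aint_y_pi s : ~~ (d %| s)%N -> y s * theta ^+ s / pi \in Aint.
Proof.
move=> ds; have m_gt0 : (0 < m)%N by rewrite muln_gt0 m'_gt0.
have [q Dq] := CratP _ (rat_y s).
have E : (y s * theta ^+ s) ^+ m = ratr (q ^+ m * (a ^ s)%N%:R).
  by rewrite exprMn exprAC theta_m Dq [RHS]rmorphM rmorphXn /= ratr_nat [in RHS]natrX.
have /intrP[n Dn] : (y s * theta ^+ s) ^+ m \in Num.int.
  by apply: Cint_rat_Aint; rewrite ?E ?Crat_rat // -E rpredX.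
have : q ^+ m * (a ^ s)%N%:R = n%:~R :> rat.
  by move: E; rewrite Dn -[n%:~R](ratr_int algC) => /fmorph_inj ->.
move/(dvdz_rat_power m'_gt0 d_gt0 pr_p pa' ds) => /dvdzP[n' En].
apply: (@root_monic_polyOver_Aint ('X^m - n'%:~R%:P)).
- rewrite /root hornerD hornerN hornerC hornerXn expr_div_n Dn En pi_m.
  rewrite rmorphM /= -pmulrn mulfK ?subrr //.
  by rewrite pnatr_eq0 -lt0n expn_gt0 prime_gt0.
- exact: monicXnsubC.
by rewrite rpredB ?rpredX ?polyOverX // polyOverC Aint_int.
Qed.

Let Aint_diff k l : l.1 = k.1 -> m%:R * b%:~R * (be k - be l) / pi \in Aint.
Proof.
move=> lk.
have -> : m%:R * b%:~R * (be k - be l) / pi =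
    \sum_(s < m) y s * (rt k ^+ s - rt l ^+ s) / pi.
  rewrite -mulr_suml; congr (_ / _).
  rewrite mulrBr -!mulrA !y_inv -sumrB.
  by apply: eq_bigr => s _; rewrite mulrBr.
apply: rpred_sum => s _.
have [/dvdnP[j ->]|ds] := boolP (d %| s)%N.
  rewrite mulnC !exprM; have /eqP -> : rt k ^+ d == rt l ^+ d.
    by rewrite (pure_conj_expd d_gt0 theta_gt0 w_prim) lk.
  by rewrite subrr mulr0 mul0r.
rewrite /pure_conj !exprMn -mulrBr mulrA mulrAC rpredM ?Aint_y_pi //.
by rewrite rpredB // rpredX // rpredX // (Aint_prim_root w_prim).
Qed.

Local Notation T :=
  (\prod_k \prod_(l | (l.1 == k.1) && (l != k)) (be k - be l)).

(** There are m (d-1) factors. Each, multiplied by m b, is divisible by [pi], and pi^(m (d-1)) =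
    p^(m' (d-1)). The quotient is a rational algebraic integer, since automorphisms preserve the
    blocks and so fix [T]. *)
Lemma pure_disc_dvd : exists2 z : int,
  T \in Crat & (m%:R * b%:~R) ^+ (m * d.-1) * T = (p ^ (m' * d.-1))%:R * z%:~R.
Proof.
have prod_c (c : algC) :
    \prod_(k : I) \prod_(l | (l.1 == k.1) && (l != k)) c = c ^+ (m * d.-1).
  under eq_bigr do rewrite prod_fiber_neq prodr_const cardC1 card_ord.
  by rewrite prodr_const card_prod !card_ord -exprM mulnC.
have rT : T \in Crat.
  apply: fixed_Crat => nu.
  have [rho [rhoE rho1]] := aut_pure_conj m'_gt0 d_gt0 theta_gt0 theta_m w_prim nu.
  rewrite rmorph_prod [RHS](reindex_inj (@perm_inj _ rho)) /=.
  apply: eq_bigr => k _.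
  rewrite rmorph_prod [RHS](reindex_inj (@perm_inj _ rho)) /=.
  apply: eq_big => [l|l _]; first by rewrite rho1 (inj_eq perm_inj).
  by rewrite rmorphB !(be_equiv rhoE).
pose U := (m%:R * b%:~R) ^+ (m * d.-1) * T.
have EU : U / (p ^ (m' * d.-1))%:R =
    \prod_(k : I) \prod_(l | (l.1 == k.1) && (l != k))
      (m%:R * b%:~R * (be k - be l) / pi).
  rewrite /U; move: (m%:R * b%:~R : algC) => c.
  under [RHS]eq_bigr do rewrite !big_split /=.
  rewrite !big_split /= !prod_c exprVn; congr (_ * _ / _).
  by rewrite exprM pi_m -natrX -expnM.
have /intrP[z Dz] : U / (p ^ (m' * d.-1))%:R \in Num.int.
  apply: Cint_rat_Aint.
    by rewrite /U rpredM ?rpredV ?rpred_nat ?rpredM ?rpredX ?rpredM ?rpred_nat ?rpred_int.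
  rewrite EU; apply: rpred_prod => k _; apply: rpred_prod => l /andP[/eqP lk _].
  exact: Aint_diff.
exists z => //; rewrite -/U -Dz mulrC divfK //.
by rewrite pnatr_eq0 -lt0n expn_gt0 prime_gt0.
Qed.

End PureFieldDisc.

(** As the content is 1, the reduction mod [p] is nonzero; its degree is less than [p], so it cannot
    vanish on the whole prime field. *)
Lemma zpoly_nonroot_modp (p : nat) (f : {poly int}) : prime p ->
  zcontents f = 1 -> (size f <= p)%N ->
  exists b : nat, ~~ (p %| absz f.[b%:Z])%N.
Proof.
move=> pr_p cf szf.
have pcharFp := pchar_Fp pr_p.
have intFp (z : int) : (z%:~R == 0 :> 'F_p) = (p %| absz z)%N.
  rewrite {1}[z]intEsign rmorphM rmorph_sign mulf_eq0 signr_eq0 /=.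
  by rewrite (dvdn_pcharf pcharFp).
pose g := map_poly (intr : int -> 'F_p) f.
have g0 : g != 0.
  apply/eqP => g0; have : (p%:Z %| zcontents f)%Z.
    rewrite dvdz_contents; apply/polyOverP => i.
    by have := congr1 (fun q : {poly 'F_p} => q`_i) g0;
       rewrite coef_map coef0 /= => /eqP; rewrite intFp.
  by rewrite cf dvdzE /= dvdn1 => /eqP p1; rewrite p1 in pr_p.
have [/existsP[x gx]|] := boolP [exists x : 'F_p, ~~ root g x].
  exists x; apply: contra gx; rewrite -intFp -horner_map /=.
  by rewrite -pmulrn natr_Zp.
rewrite negb_exists => /forallP all_root.
have : (size (enum 'F_p) < size g)%N.
  apply: max_poly_roots; rewrite ?enum_uniq //.
  by apply/allP => x _; have := all_root x; rewrite negbK.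
by rewrite -cardE card_Fp // ltnNge (leq_trans (size_poly _ _) szf).
Qed.

(** * The lower bound for the height *)

Section HeightLowerBound.

Variables (theta w : algC) (m' d p a' : nat) (C : {poly rat}).
Local Notation m := (m' * d)%N.
Local Notation a := (p ^ m' * a')%N.
Local Notation alpha := (pQtoC C).[theta].
Hypotheses (m'_gt0 : (0 < m')%N) (pr_d : prime d) (d_gt2 : (2 < d)%N).
Hypotheses (pr_p : prime p) (pa' : ~~ (p %| a')%N) (lt_mp : (m < p)%N).
Hypotheses (theta_gt0 : 0 < theta) (theta_m : theta ^+ m = a%:R)
  (min_theta : minCpoly theta = 'X^m - a%:R%:P) (w_prim : m.-primitive_root w).
Hypothesis alphaN : forall D, alpha != (pQtoC D).[theta ^+ d].

Let d_gt0 : (0 < d)%N := prime_gt0 pr_d.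
Local Notation I := ('I_m' * 'I_d)%type.
Local Notation rt := (@pure_conj theta w m' d).
Let al (k : I) := (pQtoC C).[rt k].

Let al_equiv (nu : {rmorphism algC -> algC}) (rho : {perm I}) :
  (forall k, nu (rt k) = rt (rho k)) -> forall k, nu (al k) = al (rho k).
Proof. by move=> rhoE k; rewrite /al aut_horner_rat rhoE. Qed.

Let k0 : I := (Ordinal m'_gt0, Ordinal d_gt0).

Let rt_k0 : rt k0 = theta.
Proof. by rewrite /pure_conj /= muln0 expr0 mulr1. Qed.

Let root_al k : root (minCpoly alpha) (al k).
Proof.
have [nu nuE] := pure_conj_aut theta_m min_theta w_prim k.
have -> : al k = nu alpha by rewrite aut_horner_rat nuE.
by rewrite -(minCpoly_aut nu) root_minCpoly.
Qed.

(** An automorphism taking [theta] to [rt k] brings the pair back to [k0] and an index of the same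
    block, where [conj_horner_neq] applies. *)
Let al_neq k l : k.1 = l.1 -> k != l -> al k != al l.
Proof.
move=> kl1 kl.
have [nu nuE] := pure_conj_aut theta_m min_theta w_prim k.
have [rho [rhoE rho1]] := aut_pure_conj m'_gt0 d_gt0 theta_gt0 theta_m w_prim nu.
have rho0 : rho k0 = k.
  by apply: (pure_conj_inj m'_gt0 theta_gt0 w_prim); rewrite -rhoE rt_k0 nuE.
pose l' := (rho^-1)%g l; have rhol : rho l' = l by rewrite permKV.
have l'1 : l'.1 = k0.1 by apply/eqP; rewrite -rho1 rho0 rhol kl1.
rewrite -rho0 -rhol -!(al_equiv rhoE) (inj_eq (fmorph_inj nu)) eq_sym.
have zeta_prim : d.-primitive_root (w ^+ m').
  have {1}-> : d = (m %/ gcdn m' m)%N.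
    by rewrite (gcdn_idPl _) ?dvdn_mulr // mulKn.
  exact: exp_prim_root.
have rtE (t : nat) (td : (t < d)%N) : theta * (w ^+ m') ^+ t = rt (k0.1, Ordinal td).
  by rewrite /pure_conj /= add0n exprM.
have -> : al l' = (pQtoC C).[theta * (w ^+ m') ^+ (l'.2 : nat)].
  rewrite (rtE _ (ltn_ord _)) /al -l'1; congr (_.[rt _]).
  by case: (l') => i j /=; congr (_, _); apply: val_inj.
have -> : al k0 = alpha by rewrite /al rt_k0.
apply: (conj_horner_neq theta_gt0 pr_d d_gt2 zeta_prim _ alphaN).
  move=> t; have td : (t %% d < d)%N by rewrite ltn_mod.
  have [nu' nu'E] := pure_conj_aut theta_m min_theta w_prim (k0.1, Ordinal td).
  by exists nu'; rewrite nu'E -rtE (prim_expr_mod zeta_prim).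
rewrite ltn_ord andbT lt0n; apply: contraNneq kl => l'2.
rewrite -rho0 -rhol (inj_eq perm_inj) eq_sym.
by rewrite -pair_eqE /= /pair_eq l'1 eqxx -val_eqE /= l'2.
Qed.

(** The [d] conjugates of [alpha] in one block are distinct. *)
Lemma pure_alg_deg_ge : (d <= alg_deg alpha)%N.
Proof.
rewrite -size_conjugates -[d in leqLHS]size_enum_ord.
rewrite -(size_map (fun t => al (k0.1, t))); apply: uniq_leq_size.
  rewrite map_inj_in_uniq ?enum_uniq // => t t' _ _ E.
  apply/eqP; have [//|ntt'] := boolP (t == t').
  have /al_neq/(_ _)/eqP[] : (k0.1, t).1 = (k0.1, t').1 by []; last exact: E.
  by apply: contraNneq ntt' => -[->].
by move=> _ /mapP[t _ ->]; rewrite mem_conjugates root_al.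
Qed.

Let al_family : exists r, \prod_k ('X - (al k)%:P) = minCpoly alpha ^+ r.
Proof.
apply: prod_conjugates_minCpolyX; last exact: root_al.
move=> nu; have [rho [rhoE _]] :=
  aut_pure_conj m'_gt0 d_gt0 theta_gt0 theta_m w_prim nu.
by exists rho; apply: al_equiv.
Qed.

Let card_pure_conj : #|{: I}| = m.
Proof. by rewrite card_prod !card_ord. Qed.

Lemma pure_alg_deg_le : (alg_deg alpha <= m)%N.
Proof.
have [r alE] := al_family; have Em := card_family alE.
rewrite card_pure_conj in Em; rewrite Em leq_pmull // lt0n.
have : (0 < m)%N by rewrite muln_gt0 m'_gt0.
by apply: contraTneq => r0; rewrite Em r0.
Qed.

Lemma pure_height_ge (R : realType) :
  ln ((p ^ (m' * d.-1))%N%:R : R) <=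
  ln ((d`! ^ (2 * m'))%N%:R : R)
    + (2 * d.-1)%:R * (m%:R * weil_height R alpha).
Proof.
have [r alE] := al_family.
pose B := lead_coef (min_zpoly alpha) ^+ r.
have B0 : 0 < B := lead_family_gt0 alpha r.
have B0C : 0 <= B%:~R :> algC by rewrite ler0z ltW.
have FE := min_zpolyXE alE; rewrite -/B in FE.
have AintB : B%:~R *: \prod_k ('X - (al k)%:P) \is a polyOver Aint.
  by rewrite -FE; apply/polyOverP => i; rewrite coef_map Aint_int.
have deg_le := pure_alg_deg_le.
have [b pb] : exists b : nat, ~~ (p %| absz (min_zpoly alpha).[b%:Z])%N.
  apply: zpoly_nonroot_modp => //; first exact: zcontents_min_zpoly.
  have <- : size (map_poly intr (min_zpoly alpha) : {poly algC}) = size (min_zpoly alpha).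
    by apply: size_map_inj_poly; [exact: intr_inj|].
  rewrite min_zpolyE size_scale ?intr_eq0 ?gt_eqF ?lead_min_zpoly_gt0 //.
  apply: leq_trans lt_mp; apply: (@leq_trans (alg_deg alpha).+1) => //.
  by rewrite /alg_deg leqSpred.
pose b' : int := (min_zpoly alpha ^+ r).[b%:Z].
have pb' : ~~ (p %| absz b')%N.
  rewrite /b' horner_exp abszX; apply: contra pb => h.
  by move: h; rewrite Euclid_dvdX // => /andP[].
have b'E : b'%:~R = B%:~R * \prod_k (b%:R - al k) :> algC.
  rewrite /b' -[LHS]horner_map /= FE hornerZ horner_prod -pmulrn.
  by under eq_bigr do rewrite hornerXsubC.
have b'0 : b'%:~R != 0 :> algC.
  by rewrite intr_eq0; apply: contraNneq pb' => ->; rewrite dvdn0.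
have bal k : b%:R - al k != 0.
  apply: contraNneq b'0 => balk.
  by rewrite b'E (bigD1 k) //= balk mul0r mulr0.
(* Passing from al to be makes the denominators prime to p. *)
pose be k := (b%:R - al k)^-1.
have be_equiv (nu : {rmorphism algC -> algC}) (rho : {perm I}) :
    (forall k, nu (rt k) = rt (rho k)) -> forall k, nu (be k) = be (rho k).
  by move=> rhoE k; rewrite /be fmorphV rmorphB rmorph_nat (al_equiv rhoE).
(* The factor of [b'] with index [k] cancels, leaving [B] times the product of the other b - al
   l. *)
have be_int k : b'%:~R * be k \in Aint.
  rewrite b'E (bigD1 k) //= (mulrC (b%:R - al k)) mulrA mulfK //.
  by apply: (Aint_subprodB AintB); rewrite rpred_nat.
have [pi pi_d] : exists pi : algC, pi ^+ d = p%:R.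
  by exists (d.-root p%:R); rewrite rootCK.
have [z rT Ez] := pure_disc_dvd m'_gt0 d_gt0 theta_gt0 pr_p pa' theta_m w_prim
  be_equiv be_int pi_d.
set T := \prod_k _ in rT Ez.
pose disc := \prod_k \prod_(l | (l.1 == k.1) && (l != k)) (al k - al l).
pose A : algC := B%:~R ^+ (2 * d.-1) * disc.
(* Each difference of al equals the difference of be times (b - al k)(b - al l). Over all pairs
   every b - al k occurs d - 1 times in either position, and these powers are absorbed by [b']. *)
have AE : A = b'%:~R ^+ (2 * d.-1) * T.
  rewrite /A b'E exprMn -mulrA; congr (_ * _).
  have -> : disc = \prod_k \prod_(l | (l.1 == k.1) && (l != k))
      ((b%:R - al k) * (b%:R - al l) * (be k - be l)).
    apply: eq_bigr => k _; apply: eq_bigr => l _; rewrite /be.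
    by field; rewrite !bal.
  under eq_bigr do rewrite !big_split /=.
  rewrite !big_split /= -/T; congr (_ * _).
  have prodx : \prod_k \prod_(l | (l.1 == k.1) && (l != k)) (b%:R - al k) =
      (\prod_k (b%:R - al k)) ^+ d.-1.
    rewrite -prodrXl; apply: eq_bigr => k _.
    by rewrite prod_fiber_neq prodr_const cardC1 card_ord.
  rewrite prodx (exchange_big_dep xpredT) //= mulnC exprM expr2; congr (_ * _).
  rewrite -[RHS]prodx; apply: eq_bigr => k _; apply: eq_bigl => l.
  by rewrite eq_sym [k == l]eq_sym.
have A_neq0 : A != 0.
  apply: mulf_neq0; first by rewrite expf_neq0 // intr_eq0 gt_eqF.
  apply/prodf_neq0 => k _; apply/prodf_neq0 => l /andP[/eqP lk nlk].
  by rewrite subr_eq0 al_neq // eq_sym.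
have /intrP[N DN] : A \in Num.int.
  apply: Cint_rat_Aint; last exact: (Aint_grouped_disc AintB).
  by rewrite AE rpredM ?rpredX ?rpred_int.
(* [pure_disc_dvd] gives the divisibility up to powers of [m] and [b']; [p] divides neither, as m <
   p and by the choice of [b]. *)
have dvd_N : ((p ^ (m' * d.-1))%N %| absz N)%N.
  have /(congr1 absz) : (m%:Z * b') ^+ (m * d.-1) * N =
      b' ^+ (2 * d.-1) * ((p ^ (m' * d.-1))%N%:Z * z).
    apply: (@intr_inj algC); rewrite !rmorphM !rmorphXn /= rmorphM /= -DN AE.
    by rewrite -!pmulrn mulrCA Ez natrX.
  rewrite !abszM !abszX !abszM /= => EN.
  have : ((p ^ (m' * d.-1))%N %| (m * absz b') ^ (m * d.-1) * absz N)%N.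
    by rewrite EN mulnCA dvdn_mulr.
  rewrite Gauss_dvdr // coprimeXl // coprimeXr // prime_coprime // Euclid_dvdM //.
  rewrite (negPf pb') orbF gtnNdvd //.
  by rewrite muln_gt0 m'_gt0.
have := @ln_le_height _ _ _ _ alE R (p ^ (m' * d.-1)) (d`! ^ (2 * m')) (2 * d.-1).
rewrite -/B card_pure_conj; apply; first by rewrite expn_gt0 prime_gt0.
apply: le_trans _ (normC_grouped_disc al B0C); rewrite -/disc -/A DN.
have N0 : (0 < absz N)%N by rewrite absz_gt0 -(intr_eq0 algC) -DN.
by rewrite -intr_norm -abszE -pmulrn ler_nat dvdn_leq.
Qed.

End HeightLowerBound.

(** * The tower of fields *)

(** All conjugates have absolute value [theta], so theta^deg is the absolute value of the constant
    term and is rational. Thus [m] divides the degree, while the minimal polynomial divides X^m -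
    a. *)
Lemma minCpoly_root_nat (theta : algC) (m a : nat) : (0 < m)%N -> 0 < theta ->
  theta ^+ m = a%:R -> (forall N, theta ^+ N \in Crat -> (m %| N)%N) ->
  minCpoly theta = 'X^m - a%:R%:P.
Proof.
move=> m0 th0 thm irr.
have [q [Dq mon_q] dvq] := minCpolyP theta.
have XaE : 'X^m - a%:R%:P = pQtoC ('X^m - a%:R%:P).
  by rewrite rmorphB /= map_polyXn map_polyC /= ratr_nat.
have qXa : q %| 'X^m - a%:R%:P.
  by rewrite -dvq -XaE /root hornerD hornerN hornerC hornerXn thm subrr.
have normz z : z \in conjugates theta -> `|z| = theta.
  rewrite mem_conjugates Dq => qz; have : root ('X^m - a%:R%:P) z.
    by rewrite XaE; case/dvdpP: qXa => r ->; rewrite rmorphM rootM qz orbT.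
  rewrite /root hornerD hornerN hornerC hornerXn subr_eq0 => /eqP zm.
  apply/eqP; rewrite -(@eqrXn2 _ m) ?normr_ge0 ?(ltW th0) //.
  by rewrite -normrX zm thm normr_nat.
have NE : theta ^+ alg_deg theta = `|(minCpoly theta)`_0|.
  rewrite [in RHS]conjugatesE -horner_coef0 horner_prod normr_prod.
  rewrite (eq_big_seq (fun=> theta)) => [|z /normz Ez]; last first.
    by rewrite hornerXsubC sub0r normrN.
  by rewrite big_const_seq count_predT size_conjugates iter_mulr_1.
have mN : (m %| alg_deg theta)%N.
  apply: irr; rewrite NE Dq coef_map /= -[ratr _]/((ratr : {rmorphism rat -> algC}) _).
  by rewrite -ratr_norm Crat_rat.
rewrite Dq XaE; congr (pQtoC _); apply/eqP.
rewrite -eqp_monic ?monicXnsubC // -dvdp_size_eqp //.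
rewrite size_XnsubC // eqn_leq; apply/andP; split.
  have Xa0 : 'X^m - a%:R%:P != 0 :> {poly rat} by rewrite monic_neq0 ?monicXnsubC.
  by rewrite -(size_XnsubC (a%:R : rat) m0) dvdp_leq.
have := dvdn_leq (alg_deg_gt0 theta) mN; rewrite /alg_deg Dq size_map_poly.
by have := size_poly_gt0 q; rewrite monic_neq0 //; case: (size q).
Qed.

(** Polynomial values already form the field Q(theta), because algC consists of algebraic numbers;
    see [in_adjoinV]. *)
Definition in_adjoin (theta x : algC) : Prop := exists C, x = (pQtoC C).[theta].

Section Adjoin.

Variable theta : algC.
Local Notation inQ := (in_adjoin theta).

Lemma in_adjoin_rat x : x \in Crat -> inQ x.
Proof. by move=> /CratP[q ->]; exists q%:P; rewrite map_polyC hornerC. Qed.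

Lemma in_adjoin_gen : inQ theta.
Proof. by exists 'X; rewrite map_polyX hornerX. Qed.

Lemma in_adjoinB x y : inQ x -> inQ y -> inQ (x - y).
Proof.
by move=> [C ->] [D ->]; exists (C - D); rewrite rmorphB /= hornerD hornerN.
Qed.

Lemma in_adjoinM x y : inQ x -> inQ y -> inQ (x * y).
Proof. by move=> [C ->] [D ->]; exists (C * D); rewrite rmorphM hornerM. Qed.

Lemma in_adjoinX x n : inQ x -> inQ (x ^+ n).
Proof. by move=> [C ->]; exists (C ^+ n); rewrite rmorphXn horner_exp. Qed.

Lemma in_adjoin_horner (D : {poly rat}) x : inQ x -> inQ (pQtoC D).[x].
Proof.
by move=> [C ->]; exists (D \Po C); rewrite map_comp_poly horner_comp.
Qed.

(** If the minimal polynomial of [x] is D X + q_0, then 1/x = -D(x)/q_0. *)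
Lemma in_adjoinV x : inQ x -> inQ x^-1.
Proof.
move=> Qx; have [->|x0] := eqVneq x 0; first by rewrite invr0; apply/in_adjoin_rat/Crat0.
have [q [Dq mon_q] dvq] := minCpolyP x.
pose D := \poly_(i < (size q).-1) q`_i.+1.
have qE : q = D * 'X + (q`_0)%:P.
  apply/polyP => -[|i]; rewrite coefD coefMX coefC /= ?add0r ?addr0 // coef_poly.
  by case: ltnP => // le_i; rewrite nth_default // (leq_trans (leqSpred _)).
have q0 : q`_0 != 0.
  apply: contraTneq (mon_q) => q00.
  have : root (pQtoC D) x.
    have : root (pQtoC q) x by rewrite dvq.
    rewrite qE q00 addr0 rmorphM /= map_polyX rootM => /orP[//|].
    by rewrite /root hornerX (negPf x0).
  rewrite dvq => /dvdp_leq; have [D0|D0] := eqVneq D 0.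
    by rewrite qE q00 D0 mul0r addr0 monicE lead_coef0 eq_sym oner_eq0.
  move=> /(_ isT); have := size_poly (size q).-1 (fun i => q`_i.+1); rewrite -/D.
  case: (size q) (size_poly_gt0 q); rewrite monic_neq0 // => n _ h1 h2.
  by have := leq_trans h2 h1; rewrite ltnn.
suff -> : x^-1 = (pQtoC D).[x] * - ratr (q`_0)^-1.
  apply: in_adjoinM; first exact: in_adjoin_horner.
  by apply: in_adjoin_rat; rewrite rpredN Crat_rat.
have E : (pQtoC D).[x] * x = - ratr q`_0.
  apply/eqP; rewrite -addr_eq0; have : root (pQtoC q) x by rewrite dvq.
  by rewrite {1}qE /root rmorphD rmorphM /= map_polyX map_polyC hornerD hornerMX hornerC.
apply: (mulfI x0); rewrite divff // mulrA (mulrC x) E mulrNN fmorphV divff //.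
by rewrite fmorph_eq0.
Qed.

Lemma in_adjoin_trans x y : in_adjoin x y -> inQ x -> inQ y.
Proof. by move=> [D ->]; apply: in_adjoin_horner. Qed.

End Adjoin.

(** Otherwise [d] and [N] are coprime, and Bezout makes [pi] rational, hence an integer; then [d]
    divides the p-adic valuation of [p], which is 1. *)
Lemma root_prime_Crat (d p : nat) (pi : algC) (N : nat) : prime d -> prime p ->
  pi ^+ d = p%:R -> pi ^+ N \in Crat -> (d %| N)%N.
Proof.
move=> pr_d pr_p pid ratN; have d0 := prime_gt0 pr_d.
apply: contraT; rewrite -prime_coprime // => co_dN.
have pn0 : p%:R != 0 :> algC by rewrite pnatr_eq0 -lt0n prime_gt0.
have N0 : (0 < N)%N.
  by rewrite lt0n; apply: contraTneq co_dN => ->; rewrite /coprime gcdn0 gtn_eqF ?prime_gt1.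
have [u v Euv _] := egcdnP d N0.
rewrite coprime_sym in co_dN; rewrite (eqP co_dN) in Euv.
have rat_pi : pi \in Crat.
  have -> : pi = (pi ^+ N) ^+ u / p%:R ^+ v.
    rewrite -exprM mulnC Euv exprD expr1 mulnC exprM pid mulrC mulKf //.
    by rewrite expf_neq0.
  apply: rpredM; first exact: rpredX.
  by rewrite rpredV rpredX ?rpred_nat.
have /intrP[z Dz] : pi \in Num.int.
  apply: Cint_rat_Aint => //; apply: (@root_monic_polyOver_Aint ('X^d - p%:R%:P)).
  - by rewrite /root hornerD hornerN hornerC hornerXn pid subrr.
  - exact: monicXnsubC.
  by rewrite rpredB ?rpredX ?polyOverX // polyOverC rpred_nat.
have : (absz z ^ d)%N = p.
  rewrite -abszX -[p]/(absz p%:Z); congr absz; apply: (@intr_inj algC).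
  by rewrite rmorphXn /= -Dz pid pmulrn.
move/(congr1 (logn p)); rewrite lognX (logn_prime p pr_p) eqxx => /eqP.
by rewrite muln_eq1 gtn_eqF ?prime_gt1.
Qed.

(** * The fields Q(theta_n) *)

Section RadicalTower.

Variables d p : nat -> nat.
Hypothesis d_prime : forall i, (1 <= i)%N -> prime (d i).
Hypothesis p_prime : forall i, (1 <= i)%N -> prime (p i).
Hypothesis d_lt : forall i j, (1 <= i)%N -> (i < j)%N -> (d i < d j)%N.

Definition radical i : algC := (d i).-root (p i)%:R.
Local Notation pi := radical.

Fixpoint tower_deg n := if n is n'.+1 then (tower_deg n' * d n)%N else 1%N.
Fixpoint tower_gen n : algC := if n is n'.+1 then tower_gen n' * pi n else 1.
(** The integer theta_n^(m_n), in the shape p^m' a' required by the height bound. *)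
Fixpoint tower_radicand n :=
  if n is n'.+1 then (p n ^ tower_deg n' * tower_radicand n' ^ d n)%N else 1%N.

Lemma radical_exp i : (1 <= i)%N -> pi i ^+ d i = (p i)%:R.
Proof. by move=> i1; rewrite rootCK // prime_gt0 ?d_prime. Qed.

Lemma radical_gt0 i : (1 <= i)%N -> 0 < pi i.
Proof. by move=> i1; rewrite rootC_gt0 ?ltr0n prime_gt0 ?d_prime ?p_prime. Qed.

Lemma tower_deg_gt0 n : (0 < tower_deg n)%N.
Proof. by elim: n => //= n IH; rewrite muln_gt0 IH prime_gt0 ?d_prime. Qed.

Lemma tower_gen_gt0 n : 0 < tower_gen n.
Proof. by elim: n => [|n IH] /=; rewrite ?ltr01 // mulr_gt0 ?radical_gt0. Qed.

Lemma tower_gen_exp n : tower_gen n ^+ tower_deg n = (tower_radicand n)%:R.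
Proof.
elim: n => [|n IH] /=; first by rewrite expr1n.
rewrite exprMn exprM IH mulnC exprM radical_exp // natrM !natrX.
by rewrite mulrC.
Qed.

Lemma coprime_tower_deg n j : (n < j)%N -> coprime (tower_deg n) (d j).
Proof.
elim: n => [|n IH] nj /=; first by rewrite coprime1n.
rewrite coprimeMl IH ?(ltnW nj) //= prime_coprime ?d_prime //.
rewrite dvdn_prime2 ?d_prime // ?(leq_trans _ nj) //.
by rewrite ltn_eqF // d_lt.
Qed.

Lemma tower_radicand_neq0 n : (tower_radicand n)%:R != 0 :> algC.
Proof. by rewrite -tower_gen_exp expf_neq0 // lt0r_neq0 // tower_gen_gt0. Qed.

(** Raising to the power m_n makes the part from theta_n rational, so d_(n+1) divides m_n N and
    hence N. Then pi_(n+1)^N is rational too and can be divided out, which leaves the induction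
    hypothesis for theta_n. *)
Lemma tower_gen_Crat n N : tower_gen n ^+ N \in Crat -> (tower_deg n %| N)%N.
Proof.
elim: n N => [|n IH] N /= ratN; first by rewrite dvd1n.
have dN : (d n.+1 %| N)%N.
  rewrite -(@Gauss_dvdr _ (tower_deg n)); last by rewrite coprime_sym coprime_tower_deg.
  apply: root_prime_Crat (radical_exp _) _; rewrite ?d_prime ?p_prime //.
  have : (tower_gen n * pi n.+1) ^+ (tower_deg n * N) \in Crat.
    by rewrite mulnC exprM rpredX.
  rewrite exprMn exprM tower_gen_exp => h.
  rewrite -[_ ^+ _](mulKf (expf_neq0 N (tower_radicand_neq0 n))).
  by rewrite rpredM ?rpredV ?rpredX ?rpred_nat.
rewrite Gauss_dvd ?coprime_tower_deg // dN andbT IH //.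
case/dvdnP: dN ratN => k ->; rewrite exprMn => h.
have pin0 : pi n.+1 ^+ (k * d n.+1) != 0 by rewrite expf_neq0 // lt0r_neq0 // radical_gt0.
rewrite -[_ ^+ _](mulfK pin0) rpredM ?rpredV //.
by rewrite mulnC exprM radical_exp // rpredX ?rpred_nat.
Qed.

Lemma minCpoly_tower_gen n :
  minCpoly (tower_gen n) = 'X^(tower_deg n) - (tower_radicand n)%:R%:P.
Proof.
apply: minCpoly_root_nat; rewrite ?tower_deg_gt0 ?tower_gen_gt0 ?tower_gen_exp //.
exact: tower_gen_Crat.
Qed.

(** The m_n-th power of theta_(n+1) is a rational multiple of that of pi_(n+1). With u m_n = v
    d_(n+1) + 1, its u-th power is a rational multiple of pi_(n+1). *)
Lemma radical_in_tower n : in_adjoin (tower_gen n.+1) (pi n.+1).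
Proof.
have m0 := tower_deg_gt0 n; have := coprime_tower_deg (ltnSn n) => co.
have [u v Euv _] := egcdnP (d n.+1) m0; rewrite (eqP co) in Euv.
have pn0 : (p n.+1)%:R != 0 :> algC by rewrite pnatr_eq0 -lt0n prime_gt0 ?p_prime.
have -> : pi n.+1 = (tower_gen n.+1 ^+ tower_deg n / (tower_radicand n)%:R) ^+ u
    / (p n.+1)%:R ^+ v.
  rewrite /= (exprMn (tower_deg n)) tower_gen_exp.
  rewrite [_ * _ / _]mulrC mulKf ?tower_radicand_neq0 //.
  rewrite -exprM mulnC Euv exprD expr1 mulnC exprM radical_exp // mulrAC divff ?mul1r //.
  by rewrite expf_neq0.
apply: in_adjoinM; last by apply: in_adjoin_rat; rewrite rpredV rpredX ?rpred_nat.
apply: in_adjoinX; apply: in_adjoinM; first exact/in_adjoinX/in_adjoin_gen.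
by apply: in_adjoin_rat; rewrite rpredV rpred_nat.
Qed.

Lemma tower_gen_in_tower n : in_adjoin (tower_gen n.+1) (tower_gen n).
Proof.
have -> : tower_gen n = tower_gen n.+1 * (pi n.+1)^-1.
  by rewrite /= mulfK // lt0r_neq0 // radical_gt0.
apply: in_adjoinM; first exact: in_adjoin_gen.
exact/in_adjoinV/radical_in_tower.
Qed.

Lemma in_tower_le n k x : (n <= k)%N ->
  in_adjoin (tower_gen n) x -> in_adjoin (tower_gen k) x.
Proof.
move=> /subnK <-; elim: (k - n)%N => // j IH /IH; rewrite addSn => Qx.
exact: in_adjoin_trans Qx (tower_gen_in_tower _).
Qed.

(** The union of the tower is a subfield containing all the radicals. *)
Lemma gen_field_tower x :
  gen_field [set a : algC | exists2 i : nat, (1 <= i)%N & a = (d i).-root (p i)%:R] x ->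
  exists n, in_adjoin (tower_gen n) x.
Proof.
pose K : {pred algC} := fun y => `[< exists n, in_adjoin (tower_gen n) y >].
have KP y : reflect (exists n, in_adjoin (tower_gen n) y) (y \in K) by exact: asboolP.
move=> /(_ K) h; apply/KP/h.
  split=> [|y z /KP[n ny] /KP[k kz]|y z /KP[n ny] /KP[k kz]]; apply/KP.
  - by exists 0%N; apply/in_adjoin_rat/Crat1.
  - exists (maxn n k); apply: in_adjoinB.
      exact: in_tower_le (leq_maxl _ _) ny.
    exact: in_tower_le (leq_maxr _ _) kz.
  exists (maxn n k); apply: in_adjoinM.
    exact: in_tower_le (leq_maxl _ _) ny.
  exact/in_adjoinV/(in_tower_le (leq_maxr _ _) kz).
by move=> _ [[//|i] _ ->]; apply/KP; exists i.+1; apply: radical_in_tower.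
Qed.

Lemma alg_deg_tower_le n x : in_adjoin (tower_gen n.+1) x ->
  (alg_deg x <= tower_deg n.+1)%N.
Proof.
move=> [C ->].
have [w w_prim] := C_prim_root_exists (tower_deg_gt0 n.+1).
apply: (pure_alg_deg_le C (tower_deg_gt0 n) (d_prime (ltn0Sn n)) (tower_gen_gt0 n.+1)
  (tower_gen_exp n.+1) (minCpoly_tower_gen n.+1) w_prim).
Qed.

(** This is [pure_height_ge] divided by m_n (d-1), with ln d! <= d ln d <= 2 (d-1) ln d for d =
    d_(n+1). *)
Lemma tower_height_ge (R : realType) n x : (2 < d n.+1)%N ->
  (tower_deg n.+1 < p n.+1)%N ->
  (forall j, (1 <= j <= n)%N -> p j != p n.+1) ->
  in_adjoin (tower_gen n.+1) x -> ~ in_adjoin (tower_gen n) x ->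
  (d n.+1 <= alg_deg x)%N /\
  ln ((p n.+1)%:R : R) <=
    4 * ln ((d n.+1)%:R : R) + 2 * (d n.+1)%:R * weil_height R x.
Proof.
move=> d2 lt_mp pN Qx nQx.
have pr_d : prime (d n.+1) by exact: d_prime.
have pr_p : prime (p n.+1) by exact: p_prime.
have p_rad k : (k <= n)%N -> ~~ (p n.+1 %| tower_radicand k)%N.
  elim: k => [_|k IH lt_kn] /=; first by rewrite dvdn1 gtn_eqF ?prime_gt1.
  rewrite Euclid_dvdM // !Euclid_dvdX // (negPf (IH (ltnW lt_kn))) /= orbF.
  by rewrite dvdn_prime2 ?p_prime // eq_sym negb_and pN.
have pa' : ~~ (p n.+1 %| tower_radicand n ^ d n.+1)%N.
  by rewrite Euclid_dvdX // negb_and p_rad.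
have [w w_prim] := C_prim_root_exists (tower_deg_gt0 n.+1).
case: Qx nQx => C -> nQx.
(* The d-th power of theta_(n+1) is p_(n+1) theta_n^d, which lies in Q(theta_n). *)
have alphaN D : (map_poly ratr C).[tower_gen n.+1] !=
    (map_poly ratr D).[tower_gen n.+1 ^+ d n.+1] :> algC.
  apply/eqP => E; apply: nQx; rewrite E; apply: in_adjoin_horner.
  rewrite /= exprMn radical_exp //; apply: in_adjoinM.
    exact/in_adjoinX/in_adjoin_gen.
  by apply: in_adjoin_rat; rewrite rpred_nat.
have m0 := tower_deg_gt0 n.
have th0 := tower_gen_gt0 n.+1.
have thm := tower_gen_exp n.+1.
have min_th := minCpoly_tower_gen n.+1.
split; first exact: (pure_alg_deg_ge m0 pr_d d2 th0 thm min_th w_prim alphaN).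
have := pure_height_ge m0 pr_d d2 pr_p pa' lt_mp th0 thm min_th w_prim alphaN R.
set h := weil_height R _; set D := d n.+1 in d2 *; set P := p n.+1; set m := tower_deg n.
have D1 : (0 < D.-1)%N by case: (D) d2 => [|[]].
have D0 : (0 < D)%N by exact: prime_gt0.
have lnD : ln (D`!%:R : R) <= D%:R * ln D%:R.
  rewrite mulr_natl -lnXn ?ltr0n // -natrX ler_ln ?posrE ?ltr0n ?fact_gt0 ?expn_gt0 ?D0 //.
  rewrite ler_nat fact_prod big_add1 /= big_mkord.
  rewrite -[X in (_ <= _ ^ X)%N](card_ord D) -prod_nat_const.
  by apply: leq_prod => i _; apply: ltn_ord.
rewrite !natrX !lnXn ?ltr0n ?fact_gt0 ?prime_gt0 // -[_ *+ (m * _)]mulr_natl.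
rewrite -[_ *+ (2 * _)]mulr_natl !natrM => le1.
have mR : 0 < m%:R :> R by rewrite ltr0n.
have D1R : 0 < (D.-1)%:R :> R by rewrite ltr0n.
have DE : D%:R = (D.-1)%:R + 1 :> R by rewrite -{1}(prednK D0) -natr1.
have D1ge : 1 <= (D.-1)%:R :> R by rewrite ler1n.
have lnD0 : 0 <= ln (D%:R : R) by rewrite ln_ge0 // ler1n.
rewrite -(ler_pM2l (mulr_gt0 mR D1R)); apply: le_trans le1 _.
rewrite -/m -/D; set L := ln D%:R in lnD lnD0 *.
have -> : m%:R * (D.-1)%:R * (4 * L + 2 * D%:R * h) =
  2 * m%:R * (2 * (D.-1)%:R * L) + 2 * (D.-1)%:R * (m%:R * D%:R * h) by ring.
rewrite lerD2r ler_pM2l ?mulr_gt0 //; apply: le_trans lnD _.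
by rewrite ler_wpM2r // DE mulr_natl mulr2n lerD2l.
Qed.

End RadicalTower.

(** * Growth of the sequences *)

Section Growth.

Variable R : realType.

Lemma ln_ge_half : 2^-1 <= ln 2 :> R.
Proof.
have := @le_ln1Dx R (- 2^-1); rewrite (_ : 1 + - 2^-1 = 2^-1); last by field.
rewrite lnV ?posrE // => h; have : -1 < - 2^-1 :> R by lra.
by move/h; lra.
Qed.

(** Apply ln y <= y - 1 to y = x^t. *)
Lemma ln_le_powR (t x : R) : 0 < t -> 0 < x -> ln x <= t^-1 * x `^ t.
Proof.
move=> t0 x0; have xt : 0 < x `^ t by apply: powR_gt0.
rewrite -[leLHS](mulKf (lt0r_neq0 t0)) -ln_powR ler_pM2l ?invr_gt0 //.
have h : -1 < x `^ t - 1 by lra.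
have := le_ln1Dx h; rewrite (_ : 1 + (x `^ t - 1) = x `^ t); last by ring.
by lra.
Qed.

Lemma powR_gt_eventually (t C : R) : 0 < t ->
  exists N : nat, forall n : nat, (N <= n)%N -> C < n%:R `^ t.
Proof.
move=> t0; pose C' := Num.max C 0.
have C'0 : 0 <= C' by rewrite le_max lexx orbT.
exists (Num.bound (C' `^ t^-1)) => n le_Nn.
apply: (@le_lt_trans _ _ C'); first by rewrite le_max lexx.
have -> : C' = (C' `^ t^-1) `^ t.
  by rewrite -powRrM mulVf ?lt0r_neq0 // powRr1.
apply: gt0_ltr_powR; rewrite ?nnegrE ?powR_ge0 //.
apply: lt_le_trans (archi_boundP (powR_ge0 _ _)) _.
by rewrite ler_nat.
Qed.

Section Sequences.

Variables (gamma eps : R) (d p : nat -> nat).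
Hypotheses (gamma_gt0 : 0 < gamma) (gamma_le1 : gamma <= 1) (eps_gt0 : 0 < eps).
Hypothesis d_prime : forall i, (1 <= i)%N -> prime (d i).
Hypothesis p_prime : forall i, (1 <= i)%N -> prime (p i).
Hypothesis d_growth : forall i, (2 <= i)%N -> (2 * d i.-1 <= d i)%N.
Local Notation delta := (1 - gamma + eps / 2).
Hypothesis p_lower : forall i, (1 <= i)%N -> expR ((d i)%:R `^ delta) <= (p i)%:R.
Hypothesis p_upper : forall i, (1 <= i)%N ->
  (p i)%:R <= 2 * expR ((d i)%:R `^ delta).

Lemma double_lt i j : (1 <= i)%N -> (i < j)%N -> (2 * d i <= d j)%N.
Proof.
move=> i1; elim: j => // j IH; rewrite ltnS leq_eqVlt => /orP[/eqP <-|ij].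
  by have := @d_growth i.+1; apply; rewrite ltnS.
apply: leq_trans (IH ij) _; have := @d_growth j.+1; rewrite ltnS /=.
by move=> /(_ (leq_trans i1 (ltnW ij))); apply: leq_trans; rewrite leq_pmull.
Qed.

Lemma d_increasing i j : (1 <= i)%N -> (i < j)%N -> (d i < d j)%N.
Proof.
move=> i1 ij; apply: leq_trans (double_lt i1 ij).
by rewrite -{1}[d i]mul1n ltn_pmul2r // prime_gt0 ?d_prime.
Qed.

Lemma expn2_le_d i : (2 ^ i.+1 <= d i.+1)%N.
Proof.
elim: i => [|i IH]; first by rewrite prime_gt1 ?d_prime.
by rewrite expnS (leq_trans _ (@double_lt i.+1 i.+2 _ _)) // leq_pmul2l.
Qed.

Lemma tower_deg_le n k : (n <= k)%N -> (tower_deg d n <= d k ^ n)%N.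
Proof.
elim: n => [|n IH] nk //=; rewrite expnSr leq_mul ?IH ?(ltnW nk) //.
move: nk; rewrite leq_eqVlt => /orP[/eqP -> //|nk].
by rewrite ltnW ?d_increasing.
Qed.

Lemma weighted_height_tower_gt (X : R) : exists N, forall n x, (N <= n)%N ->
  in_adjoin (tower_gen d p n.+1) x -> ~ in_adjoin (tower_gen d p n) x ->
  X < weighted_height gamma x.
Proof.
move: p_lower p_upper; move Edl : delta => dl p_low p_upp.
have dl0 : 0 < dl by rewrite -Edl; move: gamma_le1 eps_gt0; lra.
(* Halving d multiplies d^dl by 1 - kappa; this will separate p_(n+1) from the earlier primes. *)
pose kappa := 1 - 2^-1 `^ dl.
have kappa0 : 0 < kappa.
  rewrite subr_gt0 -[ltRHS](congr1 (@^~ dl) (powR1 R)).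
  by apply: gt0_ltr_powR; rewrite ?nnegrE //; lra.
(* The four terms serve in turn for [lt_mp], for 4 ln D <= P^2 / 2, for the distinctness of the
   primes, and for P > 1. *)
have [N1 HN1] := @powR_gt_eventually (dl / 2)
  (32 / dl ^+ 2 + 16 / dl + kappa^-1 + 1) (divr_gt0 dl0 (ltr0n _ 2)).
have [N2 HN2] := @powR_gt_eventually (eps / 2) (4 * X) (divr_gt0 eps_gt0 (ltr0n _ 2)).
exists (maxn 3 (maxn N1 N2)) => n x; rewrite !geq_max => /and3P[n3 nN1 nN2] Qx nQx.
have n_le_d : (n <= d n.+1)%N.
  by apply: leq_trans (expn2_le_d n); apply: ltnW; apply: leq_trans (ltn_expl n.+1 _).
have {}HN1 := HN1 _ (leq_trans nN1 n_le_d); have {}HN2 := HN2 _ (leq_trans nN2 n_le_d).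
have d2 : (2 < d n.+1)%N by apply: leq_trans n_le_d.
set D : R := (d n.+1)%:R in HN1 HN2.
set P := D `^ (dl / 2) in HN1; set E := D `^ (eps / 2) in HN2.
have D0 : 0 < D by rewrite ltr0n; apply: ltnW; apply: ltnW.
have D1 : 1 <= D by rewrite ler1n; apply: ltnW; apply: ltnW.
have PE : D `^ dl = P ^+ 2.
  by rewrite -powR_mulrn ?powR_ge0 // -powRrM; congr (_ `^ _); field.
have h1 : 0 < 32 / dl ^+ 2 by rewrite divr_gt0 // exprn_gt0.
have h2 : 0 < 16 / dl by rewrite divr_gt0.
have h3 : 0 < kappa^-1 by rewrite invr_gt0.
have P1 : 1 < P by lra.
have lp : P ^+ 2 <= ln (p n.+1)%:R.
  by rewrite -PE -[leLHS]expRK ler_ln ?posrE ?expR_gt0 ?ltr0n ?prime_gt0 ?p_prime ?p_low.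
have lnD0 : 0 <= ln D by rewrite ln_ge0.
(* As D >= 2^(n+1), one has ln m_(n+1) <= (n+1) ln D <= 2 (ln D)^2. Bounding ln D by (4/dl) D^(dl/4)
   yields (32/dl^2) P, which is less than P^2. *)
have lt_mp : (tower_deg d n.+1 < p n.+1)%N.
  rewrite -(ltr_nat R) -ltr_ln ?posrE ?ltr0n ?tower_deg_gt0 ?prime_gt0 ?p_prime //.
  apply: lt_le_trans lp.
  apply: (@le_lt_trans _ _ (n.+1%:R * ln D)).
    rewrite mulr_natl -lnXn // -natrX ler_ln ?posrE ?ltr0n ?tower_deg_gt0
      ?expn_gt0 ?(prime_gt0 (d_prime _)) //.
    by rewrite ler_nat tower_deg_le.
  have nD : n.+1%:R * 2^-1 <= ln D.
    apply: (@le_trans _ _ (n.+1%:R * ln 2)); first by rewrite ler_wpM2l // ln_ge_half.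
    rewrite mulr_natl -lnXn // -natrX ler_ln ?posrE ?ltr0n ?expn_gt0 ?(prime_gt0 (d_prime _)) //.
    by rewrite ler_nat expn2_le_d.
  pose Q := D `^ (dl / 4).
  have QE : Q ^+ 2 = P.
    by rewrite -powR_mulrn ?powR_ge0 // -powRrM; congr (_ `^ _); field.
  have lnQ : ln D <= 4 / dl * Q.
    by rewrite -[4 / dl]invf_div ln_le_powR // divr_gt0.
  apply: (@le_lt_trans _ _ (2 * (ln D * ln D))).
    by rewrite mulrA ler_wpM2r //; lra.
  apply: (@le_lt_trans _ _ (2 * (4 / dl * Q) ^+ 2)).
    by rewrite ler_pM2l // expr2 ler_pM.
  have -> : 2 * (4 / dl * Q) ^+ 2 = 32 / dl ^+ 2 * P.
    by rewrite -QE; field; rewrite lt0r_neq0.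
  by rewrite expr2 ltr_pM2r; lra.
(* Since d_j <= D/2, ln p_j is at most ln 2 + (1 - kappa) P^2, which is less than P^2 and hence than
   ln p_(n+1). *)
have pN j : (1 <= j <= n)%N -> p j != p n.+1.
  move=> /andP[j1 jn]; apply/eqP => Epj; move: lp; rewrite -Epj.
  apply/negP; rewrite -ltNge.
  have dj : (d j)%:R <= D * 2^-1.
    rewrite ler_pdivlMr // mulrC -natrM ler_nat.
    exact: double_lt j1 (jn : (j < n.+1)%N).
  have djd : (d j)%:R `^ dl <= P ^+ 2 * (1 - kappa).
    rewrite -PE (_ : 1 - kappa = 2^-1 `^ dl); last by rewrite /kappa; ring.
    rewrite -powRM ?(ltW D0) ?invr_ge0 //.
    by apply: ge0_ler_powR; rewrite ?nnegrE ?mulr_ge0 ?(ltW dl0) ?(ltW D0) ?invr_ge0.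
  have lnp : ln (p j)%:R <= ln 2 + (d j)%:R `^ dl.
    rewrite -[X in _ <= _ + X]expRK -lnM ?posrE ?expR_gt0 //.
    by rewrite ler_ln ?posrE ?mulr_gt0 ?expR_gt0 ?ltr0n ?prime_gt0 ?p_prime ?p_upp.
  have ln21 : ln 2 <= 1 :> R by have := @le_ln1Dx R 1; rewrite (_ : 1 + 1 = 2) //; apply; lra.
  have kP : 1 < kappa * P.
    by rewrite mulrC -ltr_pdivrMr // div1r; lra.
  apply: le_lt_trans lnp _; apply: (@le_lt_trans _ _ (1 + P ^+ 2 * (1 - kappa))).
    by lra.
  by nra.
have [le_deg] := tower_height_ge d_prime p_prime d_increasing R d2 lt_mp pN Qx nQx.
rewrite -/D; set h := weil_height R x => le_h.
have lnD : 4 * ln D <= P ^+ 2 / 2.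
  have lnP : ln D <= 2 / dl * P.
    by rewrite -[2 / dl]invf_div ln_le_powR // divr_gt0.
  have -> : P ^+ 2 / 2 = 4 * (P / 8 * P) by field.
  rewrite ler_pM2l //; apply: le_trans lnP _; rewrite ler_pM2r; last by lra.
  have -> : 2 / dl = 16 / dl / 8 by field; rewrite lt0r_neq0.
  by rewrite ler_pM2r //; lra.
(* From P^2 <= ln p_(n+1) <= 4 ln D + 2 D h and 4 ln D <= P^2 / 2. *)
have h_ge : P ^+ 2 / (4 * D) <= h.
  rewrite ler_pdivrMr ?mulr_gt0 //; lra.
rewrite /weighted_height -/h.
(* D^gamma P^2 / (4 D) equals E / 4, because the exponents gamma, delta and -1 add up to eps/2. *)
apply: (@lt_le_trans _ _ (E / 4)); first by lra.
apply: (@le_trans _ _ (D `^ gamma * (P ^+ 2 / (4 * D)))); last first.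
  apply: ler_pM; rewrite ?powR_ge0 ?divr_ge0 ?exprn_ge0 ?powR_ge0 //; first by lra.
  by apply: ge0_ler_powR; rewrite ?nnegrE ?ler_nat // ltW.
have -> : D `^ gamma * (P ^+ 2 / (4 * D)) = D `^ gamma * D `^ dl / D / 4.
  by rewrite -PE; field; rewrite lt0r_neq0.
rewrite -powRD; last by apply/implyP => _; exact: lt0r_neq0.
rewrite -Edl (_ : gamma + delta = eps / 2 + 1); last by ring.
rewrite powRD; last by apply/implyP => _; exact: lt0r_neq0.
by rewrite powRr1 ?(ltW D0) // mulfK ?lt0r_neq0.
Qed.

End Sequences.
End Growth.

(** * Heights of the radicals, and conclusion *)

Lemma minCpoly_radical (d p : nat) : prime d -> prime p ->
  minCpoly (d.-root p%:R) = 'X^d - p%:R%:P.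
Proof.
move=> pr_d pr_p; have d0 := prime_gt0 pr_d.
apply: minCpoly_root_nat; rewrite ?rootC_gt0 ?ltr0n ?prime_gt0 ?rootCK //.
by move=> N; apply: (root_prime_Crat pr_d pr_p); rewrite rootCK.
Qed.

(** The minimal polynomial X^d - p is monic and integral, so only the conjugates contribute, all of
    absolute value p^(1/d) > 1. *)
Lemma weil_height_radical (R : realType) (d p : nat) : prime d -> prime p ->
  alg_deg (d.-root p%:R) = d /\
  weil_height R (d.-root p%:R) = ln p%:R / d%:R.
Proof.
move=> pr_d pr_p; have d0 := prime_gt0 pr_d.
have Ef := minCpoly_radical pr_d pr_p; set x := d.-root p%:R in Ef *.
have deg_x : alg_deg x = d by rewrite /alg_deg Ef size_XnsubC.
have x0 : 0 <= x by rewrite rootC_ge0 // ler0n.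
have p1 : 1 < p%:R :> R by rewrite ltr1n prime_gt1.
have Ez : min_zpoly x = 'X^d - p%:Z%:P.
  apply: min_zpoly_monic.
  by rewrite Ef rmorphB /= map_polyXn map_polyC /= -pmulrn.
split=> //; rewrite /weil_height deg_x Ez lead_coefXnsubC // ln1 add0r.
congr (_ / _).
have ix : alg_real R x ^+ d = p%:R.
  by rewrite -alg_realX // /x rootCK // alg_real_nat.
have ix1 : 1 < alg_real R x.
  by rewrite -(@expr_gt1 _ d) ?alg_real_ge0 ?ix.
rewrite (eq_big_seq (fun=> ln (alg_real R x))) => [|z]; last first.
  rewrite mem_conjugates Ef /root hornerD hornerN hornerC hornerXn subr_eq0.
  move=> /eqP zd; suff -> : `|z| = x by rewrite (max_idPr (ltW ix1)).
  apply/eqP; rewrite -(@eqrXn2 _ d) ?normr_ge0 //.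
  by rewrite -normrX zd normr_nat /x rootCK.
rewrite big_const_seq count_predT size_conjugates deg_x iter_addr_0.
by rewrite -lnXn ?ix // (lt_trans ltr01).
Qed.

Theorem proposition2 (R : realType) (gamma eps : R) (d p : nat -> nat)
  (gamma_gt0 : 0 < gamma) (gamma_le1 : gamma <= 1) (eps_gt0 : 0 < eps)
  (d_prime : forall i, (1 <= i)%N -> prime (d i))
  (p_prime : forall i, (1 <= i)%N -> prime (p i))
  (d_growth : forall i, (2 <= i)%N -> (2 * d i.-1 <= d i)%N)
  (p_lower : forall i, (1 <= i)%N ->
     expR ((d i)%:R `^ (1 - gamma + eps / 2)) <= (p i)%:R)
  (p_upper : forall i, (1 <= i)%N ->
     (p i)%:R <= 2 * expR ((d i)%:R `^ (1 - gamma + eps / 2))) :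
  let F := gen_field
    [set a : algC | exists2 i : nat, (1 <= i)%N & a = (d i).-root (p i)%:R] in
  northcott gamma F /\ ~ bogomolov (gamma - eps) F.
Proof.
move=> F; have d_lt := d_increasing d_prime d_growth; split.
  move=> X.
  have [N HN] := weighted_height_tower_gt gamma_gt0 gamma_le1 eps_gt0 d_prime
    p_prime d_growth p_lower p_upper X.
  have := finite_bounded_height (tower_deg d N.+1) (Num.max 0 X).
  apply: sub_finite_set => x /= [Fx le_X].
  have ex_n : exists n, `[< in_adjoin (tower_gen d p n) x >].
    by have [n Qx] := gen_field_tower d_prime p_prime d_lt Fx; exists n; apply/asboolP.
  case: (ex_minnP ex_n) => n /asboolP Qx min_n.
  (* [n] is the first level containing [x]. Beyond [N], the element would be new at its level and
     its weighted height would exceed [X]. *)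
  have le_nN : (n <= N)%N.
    rewrite leqNgt; apply/negP; case: n Qx min_n => // n Qx min_n lt_Nn.
    suff /lt_le_trans/(_ le_X) : X < weighted_height gamma x by rewrite ltxx.
    apply: (HN n) => // /asboolP/min_n; by rewrite ltnn.
  have Qx' := in_tower_le d_prime p_prime d_lt (leqW le_nN) Qx.
  split; first exact: alg_deg_tower_le Qx'.
  (* The maximum with 0 covers nonpositive heights; a positive height is at most the weighted one,
     as the degree is at least 1 and gamma > 0. *)
  rewrite le_max; have [//|h0] := boolP (weil_height R x <= 0).
  rewrite -ltNge in h0; apply: le_trans le_X; rewrite /weighted_height.
  have deg1 : 1 <= (alg_deg x)%:R :> R by rewrite ler1n alg_deg_gt0.
  rewrite ler_peMl ?(ltW h0) // -[leLHS](powRr0 (alg_deg x)%:R).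
  by apply: ler_powR => //; apply: ltW.
move=> nbog; apply: nbog.
move=> U /nbhs_ballP[e /= e0 Ue].
(* The weighted height of the radical will be at most 2 D^(-eps/2), which is below [e] once
   D^(eps/2) > 2/e. *)
have [N HN] := @powR_gt_eventually R (eps / 2) (2 / e) (divr_gt0 eps_gt0 (ltr0n _ 2)).
have {}HN : 2 / e < (d N.+1)%:R `^ (eps / 2).
  apply: HN; have := expn2_le_d d_prime d_growth N; apply: leq_trans.
  exact: leq_trans (leqnSn N) (ltnW (ltn_expl N.+1 (isT : (1 < 2)%N))).
have pr_d : prime (d N.+1) by exact: d_prime.
have pr_p : prime (p N.+1) by exact: p_prime.
have [deg_x h_x] := weil_height_radical R pr_d pr_p.
set x := _.-root _ in deg_x h_x.
exists (weighted_height (gamma - eps) x).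
have wE : weighted_height (gamma - eps) x =
    (d N.+1)%:R `^ (gamma - eps) * (ln (p N.+1)%:R / (d N.+1)%:R).
  by rewrite /weighted_height deg_x h_x.
set D : R := (d N.+1)%:R in HN wE; set P : R := (p N.+1)%:R in wE.
have D0 : 0 < D by rewrite ltr0n prime_gt0.
have D1 : 1 <= D by rewrite ler1n prime_gt0.
have P1 : 1 < P by rewrite ltr1n prime_gt1.
(* A limit point requires elements other than 0 itself. *)
have w0 : 0 < weighted_height (gamma - eps) x.
  by rewrite wE mulr_gt0 ?powR_gt0 ?divr_gt0 ?ln_gt0.
split; first by rewrite gt_eqF.
  exists x => //; move=> K _; apply; by exists N.+1.
apply: Ue; rewrite /ball /= sub0r normrN gtr0_norm // wE.
have DdD : 1 <= D `^ (1 - gamma + eps / 2).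
  rewrite -[leLHS](powRr0 D); apply: ler_powR => //.
  by rewrite addr_ge0 ?subr_ge0 ?divr_ge0 // ltW.
have lnP : ln P <= 2 * D `^ (1 - gamma + eps / 2).
  have le_lnP : ln P <= ln 2 + D `^ (1 - gamma + eps / 2).
    rewrite -[X in _ <= _ + X]expRK -lnM ?posrE ?expR_gt0 //.
    rewrite ler_ln ?posrE ?mulr_gt0 ?expR_gt0 ?(lt_trans ltr01 P1) //.
    exact: p_upper.
  have ln21 : ln 2 <= 1 :> R.
    by have := @le_ln1Dx R 1; rewrite (_ : 1 + 1 = 2) //; apply; lra.
  apply: le_trans le_lnP _; rewrite mulr_natl mulr2n lerD2r.
  exact: le_trans ln21 DdD.
apply: (@le_lt_trans _ _ (2 * D `^ (- (eps / 2)))); last first.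
  by rewrite powRN ltr_pdivrMr ?powR_gt0 // mulrC -ltr_pdivrMr.
apply: (@le_trans _ _ (D `^ (gamma - eps) * (2 * D `^ (1 - gamma + eps / 2) / D))).
  by rewrite ler_pM2l ?powR_gt0 // ler_pM2r ?invr_gt0.
rewrite -(powR_inv1 (ltW D0)) -mulrA mulrCA mulrA -mulrA ler_pM2l // mulrA.
rewrite -!powRD; try by rewrite (lt0r_neq0 D0) implybT.
by apply: ler_powR => //; lra.
Qed.
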